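(* Consider the isotropic nearest-neighbor Ising model in zero magnetic field on the periodic cubic lattice $\mathbb{Z}_n^{3}$ with $N=n^3$ sites, and put $t=\tanh(\beta J)$. Let $j_1,\ldots,j_m$ be lattice sites. The correlation functions $\big\langle\prod_{i=1}^m\sigma_{j_i}\big\rangle_N$ and their thermodynamic limits $\big\langle\prod_{i=1}^m\sigma_{j_i}\big\rangle=\lim_{N\to\infty}\big\langle\prod_{i=1}^m\sigma_{j_i}\big\rangle_N$ are analytic, having power series expansions in $t$, or in $\beta J$, whose radius of convergence is bounded below as follows: the series in $t$ converges for $$|t|<(\sqrt3-\sqrt2)(\sqrt2-1)=0.131652497\cdots,$$ and the series in $\beta J$ converges for $$|\beta J|<\arctan\big[(\sqrt3-\sqrt2)(\sqrt2-1)\big]=0.130899693\cdots,$$ and the convergence is uniform in $N$, for all $N$ including $N=\infty$. Moreover, let $d$ be the largest edge of the minimal parallelepiped containing all the sites $j_1,\ldots,j_m$. Then, for every $k<n-d$, the coefficient of $t^k$ in the series for the lattice with $N=n^3$ sites equals the corresponding coefficient for every larger $N$, including the one for $N=\infty$.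
   Context: Ising model: to each site $i=(i_x,i_y,i_z)\in\mathbb{Z}_n^{3}$ (the periodic $n\times n\times n$ lattice, $N=n^3$) a spin $\sigma_i\in\{+1,-1\}$ is assigned. The zero-field interaction energy of a configuration is $\mathcal{H}_N=-J\sum_{\langle i,j\rangle}\sigma_i\sigma_j$, where the sum is over all nearest-neighbor pairs of sites; sites $i,j$ are nearest neighbors if and only if $(i_x-j_x,i_y-j_y,i_z-j_z)=(\pm1,0,0)$, $(0,\pm1,0)$ or $(0,0,\pm1)$ modulo $n$. The partition function is $Z_N=\sum_{\{\sigma_i=\pm1\}}\mathrm{e}^{-\beta\mathcal{H}_N}$ (sum over all $2^N$ configurations). For a function $A$ of the spin configuration, $\langle A\rangle_N=\frac1{Z_N}\sum_{\{\sigma_i=\pm1\}}A\,\mathrm{e}^{-\beta\mathcal{H}_N}$ and $\langle A\rangle=\lim_{N\to\infty}\langle A\rangle_N$; these depend on $\beta$ and $J$ only through $\beta J$, which is allowed to be complex. ''$N=\infty$'' refers to the limit $\langle\cdot\rangle$. When $N$ varies, the sites $j_1,\ldots,j_m$ are kept fixed as points of $\mathbb{Z}^3$ (viewed in $\mathbb{Z}_n^3$ for $n$ large enough to contain them as distinct sites). The parallelepiped has edges parallel to the lattice axes, and its edge lengths are the differences between the maximal and minimal coordinates of the sites in each direction (so $d=1$ for a nearest-neighbor pair). *)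

(* Defs.v *)
From mathcomp Require Import all_boot all_order all_algebra.
From mathcomp Require Import complex.
From mathcomp Require Import all_classical all_reals all_analysis.

Set Implicit Arguments.
Unset Strict Implicit.
Unset Printing Implicit Defensive.
Import Order.TTheory GRing.Theory Num.Theory numFieldNormedType.Exports.
Local Open Scope ring_scope.
Local Open Scope complex_scope.

(* R[i]^o is the complex numbers with their normed topology, which the library
   does not put on R[i] itself. *)
Section ComplexFunctions.
Variable R : realType.
Local Notation C := R[i]^o.

Definition cexp (z : C) : C :=
  (expR (complex.Re z) * cos (complex.Im z)) +i* (expR (complex.Re z) * sin (complex.Im z)).

Definition ccosh (z : C) : C := (cexp z + cexp (- z)) / 2.

Definition csinh (z : C) : C := (cexp z - cexp (- z)) / 2.

Definition ctanh (z : C) : C := csinh z / ccosh z.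

End ComplexFunctions.

Section Ising.
Variable R : realType.
Local Notation C := R[i]^o.

Definition lattice_point := {ffun 'I_3 -> int}.

(* The periodic lattice Z_n^3 by residues; n.-1.+1 is n as soon as 0 < n, the
   only case of interest. *)
Definition site (n : nat) := {ffun 'I_3 -> 'I_n.-1.+1}.

Definition to_site (n : nat) (x : lattice_point) : site n :=
  [ffun c => inord `|(x c %% n%:Z)%Z|%N].

Definition neighbors (n : nat) (i j : site n) : bool :=
  [exists c : 'I_3, [exists s : bool, [forall c' : 'I_3,
    ((i c')%:Z - (j c')%:Z == (-1) ^+ s * (c' == c)%:R %[mod n%:Z])%Z]]].

(* Unordered pairs of sites, so that for n = 2, where +1 = -1, every pair of
   neighbors occurs once; a site is never paired with itself (n = 1). *)
Definition neighbor_pairs (n : nat) : {set {set site n}} :=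
  [set [set ij.1; ij.2] |
    ij : site n * site n & (ij.1 != ij.2) && neighbors ij.1 ij.2].

Definition config (n : nat) := {ffun site n -> bool}.

Definition spin (n : nat) (s : config n) (i : site n) : C := (-1) ^+ s i.

Definition energy (n : nat) (J : C) (s : config n) : C :=
  - J * \sum_(e in neighbor_pairs n) \prod_(i in e) spin s i.

Definition partition_function (n : nat) (beta J : C) : C :=
  \sum_(s : config n) cexp (- (beta * energy J s)).

Definition average (n : nat) (beta J : C) (A : config n -> C) : C :=
  (partition_function n beta J)^-1 *
  \sum_(s : config n) A s * cexp (- (beta * energy J s)).

Definition correlation (m : nat) (j : 'I_m -> lattice_point) (n : nat) (beta J : C) : C :=
  average beta J (fun s : config n => \prod_(a < m) spin s (to_site n (j a))).

Local Open Scope classical_set_scope.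

Definition correlation_limit (m : nat) (j : 'I_m -> lattice_point) (beta J : C) : C :=
  limn (fun n => correlation j n beta J).

(* The lattice size is Some n for N = n^3 and None for N = oo. *)
Definition correlation_at (m : nat) (j : 'I_m -> lattice_point) (N : option nat) :
    C -> C -> C :=
  if N is Some n then correlation j n else correlation_limit j.

(* The n for which the periodic lattice contains the given sites as distinct
   sites. *)
Definition fits (m : nat) (j : 'I_m -> lattice_point) (n : nat) : Prop :=
  (0 < n)%N /\ forall a b, to_site n (j a) = to_site n (j b) -> j a = j b.

Definition fits_at (m : nat) (j : 'I_m -> lattice_point) (N : option nat) : Prop :=
  if N is Some n then fits j n else True.

Definition edge_length (m : nat) (j : 'I_m -> lattice_point) (c : 'I_3) : int :=
  let s := [seq j a c | a <- enum 'I_m] in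
  \big[Num.max/head 0 s]_(x <- s) x - \big[Num.min/head 0 s]_(x <- s) x.

Definition largest_edge (m : nat) (j : 'I_m -> lattice_point) : nat :=
  (\max_(c < 3) `|edge_length j c|)%N.

Definition power_series (a : nat -> C) (z : C) : C^nat :=
  [series a k * z ^+ k]_k.

(* The series sum_k a N k z^k converge for |z| < r, uniformly in the sizes N
   satisfying P and locally uniformly in z. *)
Definition cvg_uniformly_in_size
    (P : option nat -> Prop) (a : option nat -> nat -> C) (r : R) : Prop :=
  forall q : R, q < r ->
    {uniform [set Nz : option nat * C | P Nz.1 /\ `|Nz.2| <= q%:C],
      (fun M Nz => power_series (a Nz.1) Nz.2 M) @ \oo -->
      (fun Nz => limn (power_series (a Nz.1) Nz.2))}.

Definition t_radius : R :=
  (Num.sqrt 3 - Num.sqrt 2) * (Num.sqrt 2 - 1).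

End Ising.

(* Main.v *)
(** In a finite graph let a_B(t) be the power series, formal in t = tanh K with
    K = beta J, of the correlation of the spins at the sites of B.  For j not in C
    one has <s_j s_C> = <tanh (sum over l of K s_l) s_C>, where l runs over the
    neighbors of j.  In the l^1-norm of coefficients at |t| = x, adding a neighbor
    to the sum is dominated by the addition formula of tan, so for at most six
    neighbors the norm of the operator is at most tan (6 arctan x), which is 1 at
    x = tan (pi / 24) = (sqrt 3 - sqrt 2) (sqrt 2 - 1).  Hence the coefficients of
    all a_B satisfy |a_k| x^k <= 1, uniformly in the lattice.

    If the partition function vanished at some |t| < x, then so would all the
    unnormalized correlations, hence by Fourier inversion all the Boltzmann
    weights.  Each application of the identity raises the order in t by at least
    as much as it enlarges the box containing the sites, so coefficients of order
    k < n - d never see the periodicity.  The series in beta J is the composition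
    with tanh, whose Taylor coefficients are, up to sign, those of tan. *)
Require Import Defs.
From mathcomp Require Import all_boot all_order all_algebra.
From mathcomp Require Import complex.
From mathcomp Require Import all_classical all_reals all_analysis.
From mathcomp Require Import ring lra zify.
Import Order.TTheory GRing.Theory Num.Theory numFieldNormedType.Exports.

Set Implicit Arguments.
Unset Strict Implicit.
Unset Printing Implicit Defensive.
Local Open Scope ring_scope.

(** * Contraction in the algebra of spin products *)

(** The identity bounds correlations by other correlations, so no bound is available to start from.
    What starts the induction is that T = tanh (sum of K s_x) has no constant term in t: coefficient
    k of a correlation depends only on coefficients of lower order of other correlations, and a
    bound by 1 propagates from order to order once the norm of T is at most 1. Six neighbors make pi
    / 4, where tan is 1, split into six angles pi / 24. On a finite graph everything is a polynomial
    in t, except that correlations are quotients by the partition polynomial. Its zeros cannot be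
    excluded beforehand, since their absence is a consequence of the coefficient bound. Hence the
    formal identities are multiplied out, and the inverse of the partition polynomial is a truncated
    geometric series. The passage from formal to analytic identities (quotient, exponential, tanh,
    composition) always rests on one estimate: a polynomial without terms below order M, of norm N
    at radius r, has absolute value at most N (|z| / r)^M at z. *)

Section Contraction.
Variables (F : numFieldType) (T : Type).
Implicit Types (u v w : seq T -> {poly F}) (l B : seq T).

(* A list of sites stands for the product of their spins, so that consing x is
   multiplication by the spin s_x. *)
Definition spin_op (e : F) (x : T) w : seq T -> {poly F} :=
  fun B => w B + e *: ('X * w (x :: B)).

Definition spin_ops (e : F) l w := foldl (fun w x => spin_op e x w) w l.

Lemma coefXMS (p : {poly F}) k : ('X * p)`_k.+1 = p`_k.
Proof. by rewrite coefXM. Qed.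

(* The hypothesis is u = T v with denominators cleared, where T stands for
   tanh (sum over l of K s_x) and tanh K = 'X.  Removing a factor from both
   products is the addition formula of tanh: it replaces (u, v) by
   (u - 'X s_x v, v - 'X s_x u). *)
Lemma contraction (x : F) (tau : nat -> F) l u v (m : F) k :
  0 <= x -> (forall p, 0 <= tau p) ->
  (forall p, (p < size l)%N -> tau p.+1 = tau p + x + x * tau p * tau p.+1) ->
  0 <= m ->
  spin_ops 1 l (fun B => v B - u B) = spin_ops (-1) l (fun B => v B + u B) ->
  (forall B i, (i < k)%N -> `|(v B)`_i| * x ^+ i <= m) ->
  forall B, `|(u B)`_k| * x ^+ k <= tau (size l) * m.
Proof.
move=> x0 tau0; elim: l u v m k => [|y l IH] u v m k tauS m0 /= uv vm B.
  have : ((v B - u B)`_k = (v B + u B)`_k) by rewrite -[v B - u B]/((fun B => v B - u B) B) uv.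
  rewrite coefB coefD => /addrI /eqP; rewrite eq_sym -addr_eq0 -mulr2n mulrn_eq0 /=.
  by move=> /eqP ->; rewrite normr0 mul0r mulr_ge0.
have {}IH := IH _ _ _ _ (fun p pl => tauS p (ltnW pl)).
have tS := tauS (size l) (ltnSn _).
(* [v'] contains [u], so bounding [u] through [v'] looks circular. The factor 'X in front of [u]
   breaks the circle: only coefficients of [u] below order [k] enter. *)
elim/ltn_ind: k B vm => k IHk B vm.
pose u' B := u B - 'X * v (y :: B); pose v' B := v B - 'X * u (y :: B).
have uv' : spin_ops 1 l (fun B => v' B - u' B) =
           spin_ops (-1) l (fun B => v' B + u' B).
  move: uv; rewrite /spin_ops /=; congr (_ = _); congr foldl;
    apply: funext => A; rewrite /spin_op /u' /v' ?scale1r ?scaleN1r; ring.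
have tm : 0 <= tau (size l).+1 * m by rewrite mulr_ge0.
have ub A i : (i < k)%N -> `|(u A)`_i| * x ^+ i <= tau (size l).+1 * m.
  by move=> ik; apply: IHk => // C i' i'i; apply: vm; apply: ltn_trans ik.
have v'm A i : (i < k)%N -> `|(v' A)`_i| * x ^+ i <= m + x * (tau (size l).+1 * m).
  case: i => [|i] ik; rewrite coefB.
    rewrite coefXM subr0 (le_trans (vm _ _ ik))// lerDl mulr_ge0//.
  rewrite coefXMS (le_trans (ler_wpM2r _ (ler_normB _ _))) ?exprn_ge0// mulrDl.
  rewrite lerD ?vm// exprS mulrCA ler_wpM2l// ub//.
  by apply: ltn_trans ik.
have := IH u' v' _ k _ uv' v'm B.
have mm : 0 <= m + x * (tau (size l).+1 * m) by rewrite addr_ge0 ?mulr_ge0.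
move=> /(_ mm) u'm.
have xvm : `|('X * v (y :: B))`_k| * x ^+ k <= x * m.
  case: (k) vm => [|i] vm; first by rewrite coefXM normr0 mul0r mulr_ge0.
  by rewrite coefXMS exprS mulrCA ler_wpM2l// vm.
have -> : u B = u' B + 'X * v (y :: B) by rewrite /u' subrK.
rewrite coefD (le_trans (ler_wpM2r _ (ler_normD _ _))) ?exprn_ge0// mulrDl.
apply: (le_trans (lerD u'm xvm)).
rewrite [in leRHS]tS le_eqVlt; apply/orP; left; apply/eqP; ring.
Qed.

End Contraction.

(** * Spin sums on a finite graph and the identity for one spin *)

Section Graph.
Variables (F : numFieldType) (T : finType) (E : {set {set T}}).
Local Notation config := {ffun T -> bool}.
Implicit Types (s : config) (B : seq T) (j x : T) (f : config -> {poly F}).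

Definition sgn s x : F := (-1) ^+ s x.
Definition character B s : F := \prod_(x <- B) sgn s x.
Definition weight s : {poly F} :=
  \prod_(e in E) (1 + (\prod_(x in e) sgn s x) *: 'X).
Definition spin_sum f : {poly F} := \sum_s f s * weight s.

Definition flip j s : config := [ffun x => if x == j then ~~ s x else s x].

Lemma flipK j : involutive (flip j).
Proof. by move=> s; apply/ffunP => x; rewrite !ffunE; case: eqP => // _; rewrite negbK. Qed.

Lemma sgn_flip j s x : sgn (flip j s) x = if x == j then - sgn s x else sgn s x.
Proof. by rewrite /sgn ffunE; case: eqP => // _; rewrite signrN. Qed.

Lemma sgn2 s x : sgn s x * sgn s x = 1.
Proof. by rewrite /sgn -signr_addb addbb. Qed.

(** The list [l] enumerates the neighbors of [j]. As every edge has two ends, each edge at [j]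
    consists of [j] and exactly one member of [l]. *)
Lemma weight_split j (l : seq T) s : uniq l ->
  {in E, forall e : {set T}, #|e| = 2} ->
  (forall x, (x \in l) = (x != j) && ([set j; x] \in E)) ->
  weight s = \prod_(x <- l) (1 + (sgn s j * sgn s x) *: 'X) *
     \prod_(e in E | j \notin e) (1 + (\prod_(x in e) sgn s x) *: 'X).
Proof.
move=> ul E2 lE; rewrite /weight (bigID (fun e : {set T} => j \in e)) /=.
congr (_ * _).
have -> : \prod_(x <- l) (1 + (sgn s j * sgn s x) *: 'X) =
   \prod_(x in [set x in l]) (1 + (sgn s j * sgn s x) *: 'X) :> {poly F}.
  rewrite big_uniq//=; apply: eq_bigl => x; by rewrite inE.
have inj : {in [set x in l] &, injective (fun x => [set j; x])}.
  move=> x y; rewrite !inE !lE => /andP[xj _] /andP[yj _] /setP/(_ x).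
  by rewrite !inE eqxx orbT (negPf xj) /= => /esym/eqP.
have -> : \prod_(x in [set x in l]) (1 + (sgn s j * sgn s x) *: 'X) =
  \prod_(x in [set x in l]) (1 + (\prod_(y in [set j; x]) sgn s y) *: 'X) :> {poly F}.
  apply: eq_bigr => x; rewrite inE lE => /andP[xj _].
  by rewrite big_setU1 ?inE 1?eq_sym//= big_set1.
rewrite -(big_imset (fun e : {set T} => 1 + (\prod_(x in e) sgn s x) *: 'X) inj).
apply: eq_bigl => e; apply/andP/imsetP => [[eE je]|[x]].
  have /eqP/cards2P[a [b [ab eab]]] := E2 _ eE.
  move: je; rewrite eab !inE => /orP[] /eqP jE.
    by exists b; rewrite ?jE// inE lE jE eq_sym ab -eab.
  by exists a; rewrite ?jE 1?finset.setUC// inE lE jE ab finset.setUC -eab.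
by rewrite inE lE => /andP[xj xE] ->; rewrite xE !inE eqxx.
Qed.

Lemma prod_sgn_flip j s (A : {set T}) : j \notin A ->
  \prod_(x in A) sgn (flip j s) x = \prod_(x in A) sgn s x.
Proof.
move=> jA; apply: eq_bigr => x xA; rewrite sgn_flip; case: eqP => // xj.
by rewrite -xj xA in jA.
Qed.

(** Given the other spins, the weights of s_j = 1 and s_j = -1 are in the ratio of the products over
    [l] of 1 + t s_x and of 1 - t s_x. Cross-multiplying gives <s_j f> = <tanh (sum of K s_x) f>
    without denominators. *)
Lemma spin_sum_relation j l f : uniq l ->
  {in E, forall e : {set T}, #|e| = 2} ->
  (forall x, (x \in l) = (x != j) && ([set j; x] \in E)) ->
  (forall s, f (flip j s) = f s) ->
  spin_sum (fun s => (\prod_(x <- l) (1 + sgn s x *: 'X)) * (f s * (1 - sgn s j)%:P)) =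
  spin_sum (fun s => (\prod_(x <- l) (1 - sgn s x *: 'X)) * (f s * (1 + sgn s j)%:P)).
Proof.
move=> ul E2 lE fj; rewrite /spin_sum (reindex_inj (inv_inj (flipK j))) /=.
apply: eq_bigr => s _; rewrite !(weight_split _ ul E2 lE) fj sgn_flip eqxx opprK.
have jl x : x \in l -> (x == j) = false by rewrite lE => /andP[/negPf].
under eq_bigr do rewrite sgn_flip.
rewrite (_ : \prod_(e in E | _) (1 + (\prod_(x in e) sgn (flip j s) x) *: 'X) =
  \prod_(e in E | j \notin e) (1 + (\prod_(x in e) sgn s x) *: 'X)); last first.
  by apply: eq_bigr => e /andP[_ je]; rewrite prod_sgn_flip.
set W := \prod_(e in E | _) _.
have -> : \prod_(i <- l) (1 + (if i == j then - sgn s i else sgn s i) *: 'X) =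
   \prod_(i <- l) (1 + sgn s i *: 'X) :> {poly F}.
  by apply: eq_big_seq => x /jl ->.
have -> : \prod_(x <- l) (1 + (- sgn s j * sgn (flip j s) x) *: 'X) =
   \prod_(x <- l) (1 - (sgn s j * sgn s x) *: 'X) :> {poly F}.
  by apply: eq_big_seq => x /jl xj; rewrite sgn_flip xj mulNr scaleNr.
(* After the flip both sides carry the factor 1 + s_j. For s_j = 1 each side contains both products
   over [l]; for s_j = -1 each side is 0. *)
have [->|->] : sgn s j = 1 \/ sgn s j = -1.
- by rewrite /sgn; case: (s j); [right; rewrite expr1 | left; rewrite expr0].
- under [X in _ * (X * _) = _]eq_bigr do rewrite mul1r.
  by under [X in _ = _ * (X * _)]eq_bigr do rewrite mul1r; ring.
- by rewrite subrr polyC0; ring.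
Qed.

(** Deleting [j] from the list makes the character independent of s_j, as [spin_sum_relation]
    demands. Because [j] is not in [l], the deletion spares the neighbors that the operators
    cons. *)
Lemma spin_opsE (e : F) j l f (Y : {poly F}) B : j \notin l ->
  spin_ops e l (fun B => spin_sum (fun s => (character [seq x <- B | x != j] s)%:P * f s) * Y) B =
  spin_sum (fun s => (\prod_(x <- l) (1 + (e * sgn s x) *: 'X)) *
     ((character [seq x <- B | x != j] s)%:P * f s)) * Y.
Proof.
rewrite /spin_ops; elim: l f => [|x l IH] f /=.
  by move=> _; congr (_ * _); apply: eq_bigr => s _; rewrite big_nil mul1r.
rewrite inE negb_or => /andP[jx jl].
rewrite (_ : spin_op e x _ = fun B => spin_sum (fun s => (character [seq x <- B | x != j] s)%:P *
  ((1 + (e * sgn s x) *: 'X) * f s)) * Y); last first.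
  apply: funext => A; rewrite /spin_op /= eq_sym jx mulrA scalerAl -mulrDl; congr (_ * _).
  rewrite mulr_sumr scaler_sumr -big_split; apply: eq_bigr => s _ /=.
  rewrite /character big_cons polyCM -!mul_polyC polyCM; ring.
rewrite IH//; congr (_ * _); apply: eq_bigr => s _; rewrite big_cons; ring.
Qed.

End Graph.

(** * Power series coefficients of correlations on a finite graph *)

Lemma coef_exp_small (A : nzRingType) (q : {poly A}) i k :
  q`_0 = 0 -> (k < i)%N -> (q ^+ i)`_k = 0.
Proof.
move=> q0; elim: i k => // i IH k ki; rewrite exprS coefM big1// => -[[|a] /= ak] _.
  by rewrite q0 mul0r.
by rewrite IH ?mulr0//; lia.
Qed.

Lemma coefM_eq (A : nzRingType) (p p' q q' : {poly A}) k :
  (forall i, (i <= k)%N -> p`_i = p'`_i) -> (forall i, (i <= k)%N -> q`_i = q'`_i) ->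
  (p * q)`_k = (p' * q')`_k.
Proof.
move=> pp qq; rewrite !coefM; apply: eq_bigr => -[i /= ik] _.
by rewrite pp ?qq//; lia.
Qed.

Section Coefficients.
Variables (F : numFieldType) (T : finType) (E : {set {set T}}).
Local Notation config := {ffun T -> bool}.
Implicit Types (s : config) (B : seq T) (j x : T).
Local Notation character := (@character F T).
Local Notation spin_sum := (@spin_sum F T E).

(** The scaling gives [corr_num [::]] the constant term 1, so that [inv_sum K] inverts it modulo
    terms of order [K], and [corr_coef B] lists the coefficients of the formal quotient. *)
Definition corr_num B : {poly F} :=
  ((spin_sum (fun=> 1))`_0)^-1 *: spin_sum (fun s => (character B s)%:P).
Definition inv_sum K : {poly F} := \sum_(i < K) (1 - corr_num [::]) ^+ i.
Definition corr_coef B k : F := (corr_num B * inv_sum k.+1)`_k.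

Lemma coef0_weight s : (weight F E s)`_0 = 1.
Proof.
rewrite -horner_coef0 horner_prod big1// => e _.
by rewrite hornerD hornerZ hornerX hornerC mulr0 addr0.
Qed.

Lemma coef0_spin_sum B : (spin_sum (fun s => (character B s)%:P))`_0 = \sum_s character B s.
Proof.
by rewrite /spin_sum coef_sum; apply: eq_bigr => s _; rewrite coefCM coef0_weight mulr1.
Qed.

Lemma spin_sum_nil : spin_sum (fun s => (character [::] s)%:P) = spin_sum (fun=> 1).
Proof. by apply: eq_bigr => s _; rewrite /character big_nil. Qed.

Lemma coef0_spin_sum1 : (spin_sum (fun=> 1))`_0 = #|{: config}|%:R.
Proof.
rewrite -spin_sum_nil coef0_spin_sum /character.
by under eq_bigr do rewrite big_nil; rewrite sumr_const.
Qed.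

Lemma spin_sum1_neq0 : (spin_sum (fun=> 1))`_0 != 0.
Proof. by rewrite coef0_spin_sum1 pnatr_eq0 card_ffun card_bool expn_eq0. Qed.

Lemma coef0_corr_num B : (corr_num B)`_0 = #|{: config}|%:R^-1 * \sum_s character B s.
Proof. by rewrite coefZ coef0_spin_sum coef0_spin_sum1. Qed.

Lemma corr_num_nil0 : (corr_num [::])`_0 = 1.
Proof.
rewrite coef0_corr_num /character; under eq_bigr do rewrite big_nil.
by rewrite sumr_const mulVf// -coef0_spin_sum1 spin_sum1_neq0.
Qed.

Lemma corr_num_eq B B' : (forall s, character B s = character B' s) -> corr_num B = corr_num B'.
Proof. by move=> BB; congr (_ *: _); apply: eq_bigr => s _; rewrite BB. Qed.

Lemma corr_coef_eq B B' : (forall s, character B s = character B' s) -> corr_coef B = corr_coef B'.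
Proof. by move=> /corr_num_eq BB; apply: funext => k; rewrite /corr_coef BB. Qed.

Lemma corr_coefE K B k : (k < K)%N -> (corr_num B * inv_sum K)`_k = corr_coef B k.
Proof.
move=> kK; apply: coefM_eq => // i ik.
rewrite /inv_sum -(subnKC kK) big_split_ord /= coefD [X in _ + X]coef_sum [X in _ + X = _]big1 ?addr0// => a _.
by rewrite coef_exp_small ?coefB ?coef1 ?corr_num_nil0 ?subrr//=; lia.
Qed.

Lemma corr_num_inv_sum K : corr_num [::] * inv_sum K = 1 - (1 - corr_num [::]) ^+ K.
Proof.
have := subrXX 1 (1 - corr_num [::]) K.
rewrite expr1n subKr => ->; congr (_ * _).
by apply: eq_bigr => i _; rewrite expr1n mul1r.
Qed.

Lemma corr_coef_nil k : corr_coef [::] k = (k == 0)%:R.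
Proof.
rewrite /corr_coef corr_num_inv_sum coefB coef1 coef_exp_small ?subr0//.
by rewrite coefB coef1 corr_num_nil0 subrr.
Qed.

(** This multiplied-out form still makes sense at a zero of the partition polynomial, which is why
    the analytic comparison starts from it. *)
Lemma corr_coef_quotient M B k : (k < M)%N ->
  (corr_num [::] * \poly_(i < M) corr_coef B i)`_k = (corr_num B)`_k.
Proof.
move=> kM; rewrite (coefM_eq (p' := corr_num [::]) (q' := corr_num B * inv_sum k.+1))//.
  rewrite mulrCA corr_num_inv_sum mulrBr mulr1 coefB [X in _ - X]coefM big1 ?subr0// => i _.
  rewrite (coef_exp_small (i := k.+1)) ?mulr0//; last by case: i => /=; lia.
  by rewrite coefB coef1 corr_num_nil0 subrr.
move=> i ik; rewrite coef_poly (leq_ltn_trans ik kM) corr_coefE//.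
Qed.

Lemma reduce_character j B s : character B s =
  character (if odd (count_mem j B) then j :: [seq x <- B | x != j] else [seq x <- B | x != j]) s.
Proof.
elim: B => //= x B; rewrite /character big_cons => ->.
have [->|xj] := eqVneq x j; rewrite /= ?oddD/=.
  by case: odd => //=; rewrite !big_cons// mulrA sgn2 mul1r.
by case: odd => //=; rewrite !big_cons// mulrCA.
Qed.

Lemma sum_character_flip j B : j \notin B -> \sum_s character (j :: B) s = 0.
Proof.
move=> jB; have : \sum_s character (j :: B) s = - \sum_s character (j :: B) s.
  rewrite [LHS](reindex_inj (inv_inj (flipK j))) /= -sumrN; apply: eq_bigr => s _.
  rewrite /character !big_cons sgn_flip eqxx mulNr; congr (- (_ * _)).
  by apply: eq_big_seq => x xB; rewrite sgn_flip; case: eqP => // xj; rewrite -xj xB in jB.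
by move/eqP; rewrite -addr_eq0 -mulr2n mulrn_eq0 => /eqP.
Qed.

Lemma corr_coef_order0 j B : j \notin B -> corr_coef (j :: B) 0 = 0.
Proof.
move=> jB; rewrite /corr_coef coefM big_ord1 coef0_corr_num sum_character_flip//.
by rewrite mulr0 mul0r.
Qed.

Hypothesis card_edge : {in E, forall e : {set T}, #|e| = 2}.

(** Reversing all spins preserves every weight, because an edge has two ends, and changes the sign
    of a single spin. *)
Lemma corr_coef_single j k : corr_coef [:: j] k = 0.
Proof.
suff /eqP : corr_num [:: j] = - corr_num [:: j].
  rewrite -subr_eq0 opprK => /eqP e; rewrite /corr_coef.
  have -> : corr_num [:: j] = 0.
    apply/polyP => i; have := congr1 (fun p : {poly F} => p`_i) e.
    by rewrite coefD !coef0 => /eqP; rewrite -mulr2n mulrn_eq0 => /eqP.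
  by rewrite mul0r coef0.
pose g s : config := [ffun x => ~~ s x].
have gK : involutive g by move=> s; apply/ffunP => x; rewrite !ffunE negbK.
rewrite /corr_num /spin_sum -scalerN; congr (_ *: _).
rewrite [LHS](reindex_inj (inv_inj gK)) -sumrN; apply: eq_bigr => s _ /=.
have sg x : sgn F (g s) x = - sgn F s x by rewrite /sgn ffunE signrN.
rewrite /character !big_seq1 sg polyCN mulNr; congr (- (_ * _)).
apply: eq_bigr => e eE; congr (1 + _ *: _).
under eq_bigr do rewrite sg.
by rewrite prodrN (eqP (introT eqP (card_edge eE))) sqrrN expr1n mul1r.
Qed.

(** [spin_sum_relation] in the shape that [contraction] takes: [v] and [u] are the functionals
    without and with the factor s_j, and the truncated inverse is a common factor. *)
Lemma corr_relation j (l : seq T) K : uniq l ->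
  (forall x, (x \in l) = (x != j) && ([set j; x] \in E)) ->
  let v B := corr_num [seq x <- B | x != j] * inv_sum K in
  let u B := corr_num (j :: [seq x <- B | x != j]) * inv_sum K in
  spin_ops 1 l (fun B => v B - u B) = spin_ops (-1) l (fun B => v B + u B).
Proof.
move=> ul lE v u; apply: funext => B.
have jl : j \notin l by rewrite lE eqxx.
pose Y := ((spin_sum (fun=> 1))`_0)^-1 *: inv_sum K.
have uvE (c : F) : (fun B => v B + c *: u B) = fun B =>
    spin_sum (fun s => (character [seq x <- B | x != j] s)%:P * (1 + c * sgn F s j)%:P) * Y.
  apply: funext => C; rewrite /v /u /Y /corr_num.
  rewrite [spin_sum (fun s => _ * _)](_ : _ =
      spin_sum (fun s => (character [seq x <- C | x != j] s)%:P) +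
      c%:P * spin_sum (fun s => (character (j :: [seq x <- C | x != j]) s)%:P)).
    by rewrite -!mul_polyC; ring.
  rewrite mulr_sumr -big_split; apply: eq_bigr => s _ /=.
  by rewrite /character big_cons !(polyCM, polyCD); ring.
have -> : (fun B => v B - u B) = fun B => v B + (-1) *: u B by apply: funext => C; rewrite scaleN1r.
have -> : (fun B => v B + u B) = fun B => v B + 1 *: u B by apply: funext => C; rewrite scale1r.
rewrite !uvE !spin_opsE//; congr (_ * _).
transitivity (spin_sum (fun s => \prod_(x <- l) (1 + sgn F s x *: 'X) *
   ((character [seq x <- B | x != j] s)%:P * (1 - sgn F s j)%:P))).
  by apply: eq_bigr => s _; rewrite mulN1r; under eq_bigr do rewrite mul1r.
rewrite (spin_sum_relation ul)//.
  by apply: eq_bigr => s _; rewrite mul1r; under eq_bigr do rewrite -scaleNr -mulN1r.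
move=> s; congr (_%:P); apply: eq_big_seq => x.
by rewrite mem_filter sgn_flip => /andP[/negPf ->].
Qed.

(** Induction on the order and then on the length of the list. If [j] occurs an even number of
    times, its spins cancel and the list shrinks; otherwise [contraction] bounds order [k] by lower
    orders, which are at most 1 for every list. *)
Lemma corr_coef_bound (x : F) (tau : nat -> F) d :
  0 <= x -> (forall p, 0 <= tau p) -> (forall p, (p <= d)%N -> tau p <= 1) ->
  (forall p, (p < d)%N -> tau p.+1 = tau p + x + x * tau p * tau p.+1) ->
  (forall j, exists l : seq T, [/\ uniq l, (size l <= d)%N &
     forall x, (x \in l) = (x != j) && ([set j; x] \in E)]) ->
  forall B k, `|corr_coef B k| * x ^+ k <= 1.
Proof.
move=> x0 tau0 tau1 tauS nbE B k; elim/ltn_ind: k B => k IHk B.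
have [n nB] := ubnP (size B); elim: n B nB => // n IHn [|j B] nB.
  rewrite corr_coef_nil; case: k {IHk IHn} => [|k].
    by rewrite eqxx normr1 mulr1.
  by rewrite normr0 mul0r ler01.
rewrite (corr_coef_eq (reduce_character j (j :: B))) /= eqxx /=.
case: ifP => _; last by apply: IHn; rewrite size_filter (leq_ltn_trans (count_size _ _)).
have [l [ul ld lE]] := nbE j.
have rel := corr_relation k.+1 ul lE.
have := contraction x0 tau0 (fun p pl => tauS p (leq_trans pl ld)) ler01 rel (k := k) _ B.
rewrite corr_coefE// mulr1 => h; apply: le_trans (tau1 _ ld); apply: h => C i ik.
by rewrite corr_coefE ?IHk// (ltn_trans ik).
Qed.

End Coefficients.

(** * Periodic lattices *)

Section Lattice.
Implicit Types (n : nat) (x y : lattice_point) (C : seq lattice_point).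

Definition step y (cs : 'I_3 * bool) : lattice_point :=
  [ffun c => y c + (-1) ^+ cs.2 * (c == cs.1)%:R].

Definition steps y : seq lattice_point := [seq step y cs | cs <- enum {: 'I_3 * bool}].

Lemma stepE y c0 s c :
  step y (c0, s) c = if c == c0 then (if s then y c - 1 else y c + 1) else y c.
Proof.
rewrite ffunE /=; case: (c == c0); last by rewrite mulr0 addr0.
by rewrite mulr1; case: s; rewrite ?expr1 ?expr0.
Qed.

Lemma size_steps y : size (steps y) = 6.
Proof. by rewrite size_map -cardE card_prod card_ord card_bool. Qed.

Lemma to_siteE n x c : (0 < n)%N -> (to_site n x c)%:Z = (x c %% n%:Z)%Z.
Proof.
move=> n0; have nz : n%:Z != 0 by lia.
have := modz_ge0 (x c) nz; have := ltz_pmod (x c) (d := n%:Z); rewrite ltz_nat => /(_ n0).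
by rewrite ffunE; move: (x c %% _)%Z => m mn m0; rewrite inordK; lia.
Qed.

Lemma to_site_eqP n x y : (0 < n)%N ->
  (to_site n x = to_site n y) <-> forall c, (x c = y c %[mod n%:Z])%Z.
Proof.
move=> n0; split=> [e c|e]; first by rewrite -!to_siteE// e.
by apply/ffunP => c; apply/val_inj/eqP; rewrite -eqz_nat !to_siteE// e.
Qed.

Lemma to_site_surj n (i : site n) : (0 < n)%N -> i = to_site n [ffun c => (i c : nat)%:Z].
Proof.
move=> n0; apply/ffunP => c; apply/val_inj/eqP; rewrite -eqz_nat to_siteE// ffunE.
by have := ltn_ord (i c); rewrite [X in (_ < X)%N]prednK// => ic; rewrite modz_small//= ltz_nat.
Qed.

Lemma neighbors_stepP n x y : (0 < n)%N ->
  reflect (exists cs, to_site n x = to_site n (step y cs))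
    (neighbors (to_site n x) (to_site n y)).
Proof.
move=> n0; have e c d : (((to_site n x c)%:Z - (to_site n y c)%:Z == d %[mod n%:Z])%Z) =
    (x c == y c + d %[mod n%:Z])%Z.
  by rewrite !to_siteE// -(eqz_modDr (y c %% n%:Z)%Z) subrK modz_mod modzDmr addrC.
apply: (iffP existsP) => [[c /existsP[s /forallP h]]|[[c s] /(to_site_eqP _ _ n0) h]].
  exists (c, s); apply/to_site_eqP => // c'; have := h c'; rewrite e ffunE => /eqP.
  by [].
exists c; apply/existsP; exists s; apply/forallP => c'; rewrite e; apply/eqP.
by rewrite h ffunE.
Qed.

Lemma neighbors_sym n (i j : site n) : neighbors i j = neighbors j i.
Proof.
suff H (i' j' : site n) : neighbors i' j' -> neighbors j' i' by apply/idP/idP; exact: H.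
move=> /existsP[c /existsP[s /forallP h]]; apply/existsP; exists c; apply/existsP.
exists (~~ s); apply/forallP => c'; have := h c'; rewrite !eqz_mod_dvd signrN.
rewrite [X in _ -> (_ %| X)%Z](_ : _ = - ((i' c')%:Z - (j' c')%:Z - (-1) ^+ s * (c' == c)%:R)).
  by rewrite rpredN.
by ring.
Qed.

Lemma mem_neighbor_pairs n (i j : site n) :
  ([set j; i] \in neighbor_pairs n) = (i != j) && neighbors i j.
Proof.
apply/imsetP/andP => [[[a b] /=]|[ij nij]]; last first.
  by exists (i, j); rewrite ?inE ?ij//= finset.setUC.
rewrite inE /= => /andP[ab nab] e.
have: (a == j) || (a == i) by rewrite -!finset.in_set1 -finset.in_setU e !inE eqxx.
have: (b == j) || (b == i) by rewrite -!finset.in_set1 -finset.in_setU e !inE eqxx orbT.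
move=> /orP[]/eqP bE /orP[]/eqP aE; subst; rewrite ?eqxx// in ab *.
by rewrite eq_sym neighbors_sym.
Qed.

Lemma card_neighbor_pair n : {in neighbor_pairs n, forall e : {set site n}, #|e| = 2}.
Proof. by move=> e /imsetP[[a b]]; rewrite inE /= => /andP[ab _] ->; rewrite cards2 ab. Qed.

Lemma mem_map_steps n y (i : site n) : (0 < n)%N ->
  (i \in map (to_site n) (steps y)) = neighbors i (to_site n y).
Proof.
move=> n0; rewrite (to_site_surj i n0); apply/mapP/neighbors_stepP => // -[].
  by move=> _ /mapP[cs _ ->] h; exists cs.
by move=> cs h; exists (step y cs) => //; apply: map_f; rewrite mem_enum.
Qed.

(** For n = 1 every step returns to the site itself, and for n = 2 opposite steps coincide; the
    filter and [undup] take care of these lattices. *)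
Lemma neighbor_list n (j : site n) : (0 < n)%N ->
  exists l : seq (site n), [/\ uniq l, (size l <= 6)%N &
     forall i, (i \in l) = (i != j) && ([set j; i] \in neighbor_pairs n)].
Proof.
move=> n0; pose y : lattice_point := [ffun c => (j c : nat)%:Z].
exists (undup [seq i <- map (to_site n) (steps y) | i != j]); split.
- exact: undup_uniq.
- rewrite (leq_trans (size_undup _))// size_filter (leq_trans (count_size _ _))//.
  by rewrite size_map size_steps.
- move=> i; rewrite mem_undup mem_filter mem_map_steps// -to_site_surj//.
  by rewrite mem_neighbor_pairs; case: eqVneq.
Qed.

Definition in_box C (e : nat) := exists lo : 'I_3 -> int,
  forall y : lattice_point, y \in C -> forall c, lo c <= y c <= lo c + e%:Z.

Lemma in_box_sub C C' e : {subset C' <= C} -> in_box C e -> in_box C' e.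
Proof. by move=> CC [lo h]; exists lo => y /CC; exact: h. Qed.

(** Coordinates inside the box differ by less than [n], so a difference divisible by [n] is 0. *)
Lemma in_box_inj C e n : in_box C e -> (e < n)%N -> {in C &, injective (to_site n)}.
Proof.
move=> [lo h] en x y xC yC /to_site_eqP xy; apply/ffunP => c.
have /eqP := xy (leq_ltn_trans (leq0n e) en) c.
have := h x xC c; have := h y yC c; rewrite eqz_mod_dvd => hy hx /dvdzP[q qE].
have n0 : 0 <= n%:Z by [].
have q1 : q < 1.
  by rewrite ltNge; apply/negP => q1; have := ler_wpM2r n0 q1; rewrite -qE; lia.
have q2 : -1 < q.
  by rewrite ltNge; apply/negP => q2; have := ler_wpM2r n0 q2; rewrite -qE; lia.
have q0 : q = 0 by lia.
by move: qE; rewrite q0 mul0r => /eqP; rewrite subr_eq0 => /eqP.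
Qed.

(** A neighbor of [y] leaves the box in at most one direction, and by at most one unit. *)
Lemma in_box_step y C x e : x \in steps y -> in_box (y :: C) e -> in_box (y :: x :: C) e.+1.
Proof.
move=> /mapP[[c0 s] _ ->] [lo h].
exists (fun c => if s && (c == c0) then lo c - 1 else lo c) => z.
have hz (z' : lattice_point) : z' \in y :: C -> forall c, (if s && (c == c0) then lo c - 1 else lo c) <= z' c
    <= (if s && (c == c0) then lo c - 1 else lo c) + e.+1%:Z.
  by move=> /h z'h c; have := z'h c; case: ifP => _; lia.
rewrite !inE => /or3P[/eqP ->|/eqP ->|zC]; try by apply: hz; rewrite inE ?eqxx ?zC ?orbT.
move=> c; rewrite stepE; have := h y (mem_head _ _) c.
by case: s {hz}; case: (c == c0) => /=; lia.
Qed.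

Lemma step_inj y : injective (step y).
Proof.
move=> [c s] [c' s'] /ffunP /(_ c); rewrite !stepE eqxx.
case: (eqVneq c c') => [->|_]; first by case: s s' => -[]//; lia.
by case: s; lia.
Qed.

Lemma in_box_steps y : in_box (y :: steps y) 2.
Proof.
exists (fun c => y c - 1) => z; rewrite inE => /orP[/eqP ->|/mapP[[c0 s] _ ->]] c.
  by lia.
by rewrite stepE; case: s; case: (c == c0); lia.
Qed.

Lemma step_neq y cs : step y cs != y.
Proof.
case: cs => c s; apply/eqP => /ffunP/(_ c); rewrite stepE eqxx.
by case: s => /eqP; rewrite -subr_eq0 addrAC subrr add0r.
Qed.

(** A point and its six neighbors lie in a box of edge 2, which embeds in the lattice when 2 < n. So
    [steps y] describes the neighborhood of [y] on all these lattices at once, which allows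
    comparing them. *)
Lemma neighbor_list_steps n y : (2 < n)%N ->
  uniq (map (to_site n) (steps y)) /\
  forall i, (i \in map (to_site n) (steps y)) =
     (i != to_site n y) && ([set to_site n y; i] \in neighbor_pairs n).
Proof.
move=> n2; have inj := in_box_inj (in_box_steps y) n2.
have n0 : (0 < n)%N by lia.
split.
  rewrite map_inj_in_uniq; last first.
    by move=> a b ha hb; apply: inj; rewrite inE ?ha ?hb orbT.
  by rewrite map_inj_uniq ?enum_uniq//; exact: step_inj.
move=> i; rewrite mem_map_steps// mem_neighbor_pairs andbA andbb.
case: eqVneq => // ->; apply/negbTE/negP; rewrite -mem_map_steps// => /mapP[x xy].
move=> /inj; rewrite mem_head inE xy orbT => /(_ isT isT) yx.
by move: xy => /mapP[cs _]; rewrite -yx => /esym/eqP; rewrite (negPf (step_neq _ _)).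
Qed.

End Lattice.

(** * Independence of the coefficients from the lattice size *)

Section Stability.
Variable F : numFieldType.
Implicit Types (n : nat) (x y : lattice_point) (C : seq lattice_point).

Definition lattice_coef n C k : F :=
  corr_coef F (neighbor_pairs n) (map (to_site n) C) k.

(** Subtracting [w] leaves only terms with a factor 'X. Each such factor lowers the order that is
    read by one and conses a neighbor of [y], which enlarges the box by at most one, so the sum of
    edge and order stays below [N]. *)
Lemma spin_ops_stable (T T' : Type) (f : lattice_point -> T) (f' : lattice_point -> T')
  (w : seq T -> {poly F}) (w' : seq T' -> {poly F}) (s : F) y (l : seq lattice_point) N k :
  {subset l <= steps y} ->
  (forall C i e, in_box (y :: C) e -> (e + i < N)%N -> (i < k)%N ->
     (w (map f C))`_i = (w' (map f' C))`_i) ->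
  forall C e, in_box (y :: C) e -> (e + k < N)%N ->
  (spin_ops s (map f l) w (map f C))`_k - (w (map f C))`_k =
  (spin_ops s (map f' l) w' (map f' C))`_k - (w' (map f' C))`_k.
Proof.
elim: l w w' => [|x l IH] w w' ly h C e Ce ek; first by rewrite !subrr.
have xy : x \in steps y by apply: ly; rewrite mem_head.
have op C' i e' : in_box (y :: C') e' -> (e' + i < N)%N -> (i <= k)%N ->
   (spin_op s (f x) w (map f C'))`_i - (w (map f C'))`_i =
   (spin_op s (f' x) w' (map f' C'))`_i - (w' (map f' C'))`_i.
  move=> C'e' e'i ik; rewrite /spin_op !coefD !coefZ ![_ + _ - _]addrAC !subrr !add0r.
  congr (_ * _); rewrite !coefXM; case: i e'i ik => //= i e'i ik.
  by apply: (h (x :: C') i e'.+1) => //; [exact: in_box_step | lia].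
have := IH (spin_op s (f x) w) (spin_op s (f' x) w') _ _ C e Ce ek.
move=> H; have := op C k e Ce ek (leqnn k); move: H => /[swap] opC H.
have := congr2 (fun a b => a + b) (H _ _) opC; rewrite !subrKA; apply.
  by move=> z zl; apply: ly; rewrite inE zl orbT.
move=> C' i e' C'e' e'i ik; have := op C' i e' C'e' e'i (ltnW ik).
by rewrite (h C' i e')// => /addIr.
Qed.

Lemma filter_to_site n y C e : in_box (y :: C) e -> (e < n)%N ->
  [seq i <- map (to_site n) C | i != to_site n y] = map (to_site n) [seq x <- C | x != y].
Proof.
move=> Ce en; rewrite filter_map; congr map; apply: eq_in_filter => x xC /=.
apply/negb_inj; rewrite !negbK; apply/eqP/eqP => [/(in_box_inj Ce en)|->//].
by rewrite mem_head inE xC orbT; apply.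
Qed.

Lemma map_cons_notin n y C e : in_box (y :: C) e -> (e < n)%N -> y \notin C ->
  to_site n y \notin map (to_site n) C.
Proof.
move=> Ce en; apply: contra => /mapP[x xC /(in_box_inj Ce en)].
by rewrite mem_head inE xC orbT => ->.
Qed.

Lemma lattice_coef_stable_step n n' y C k e : (2 < n)%N -> (n <= n')%N -> y \notin C ->
  in_box (y :: C) e -> (e + k < n)%N ->
  (forall C' i e', in_box C' e' -> (e' + i < n)%N -> (i < k)%N ->
     lattice_coef n C' i = lattice_coef n' C' i) ->
  lattice_coef n (y :: C) k = lattice_coef n' (y :: C) k.
Proof.
move=> n2 nn' yC Ce ek IH.
pose v N (B : seq (site N)) := corr_num F (neighbor_pairs N)
   [seq x <- B | x != to_site N y] * inv_sum F (neighbor_pairs N) k.+1.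
pose u N (B : seq (site N)) := corr_num F (neighbor_pairs N)
   (to_site N y :: [seq x <- B | x != to_site N y]) * inv_sum F (neighbor_pairs N) k.+1.
have rel N : (2 < N)%N -> spin_ops 1 (map (to_site N) (steps y)) (fun B => v N B - u N B) =
    spin_ops (-1) (map (to_site N) (steps y)) (fun B => v N B + u N B).
  by move=> N2; have [ul lE] := neighbor_list_steps y N2; exact: (corr_relation F (@card_neighbor_pair N) k.+1 ul lE).
have vE N C' e' i : (n <= N)%N -> in_box (y :: C') e' -> (e' + i < n)%N -> (i <= k)%N ->
    (v N (map (to_site N) C'))`_i = lattice_coef N [seq x <- C' | x != y] i.
  move=> nN C'e' e'i ik; rewrite /v corr_coefE// (filter_to_site C'e')//; lia.
have uE N C' e' i : (n <= N)%N -> in_box (y :: C') e' -> (e' + i < n)%N -> (i <= k)%N ->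
    (u N (map (to_site N) C'))`_i = lattice_coef N (y :: [seq x <- C' | x != y]) i.
  move=> nN C'e' e'i ik; rewrite /u corr_coefE// (filter_to_site C'e')//; lia.
have sub C' e' : in_box (y :: C') e' -> in_box (y :: [seq x <- C' | x != y]) e'.
  apply: in_box_sub => z; rewrite !inE mem_filter => /orP[->//|/andP[_ ->]].
  by rewrite orbT.
have sub' C' e' : in_box (y :: C') e' -> in_box [seq x <- C' | x != y] e'.
  move=> /sub; apply: in_box_sub => z zC'; by rewrite inE zC' orbT.
have hv C' i e' : in_box (y :: C') e' -> (e' + i < n)%N -> (i < k)%N ->
   (v n (map (to_site n) C'))`_i = (v n' (map (to_site n') C'))`_i.
  move=> C'e' e'i ik; rewrite (vE n C' e' i (leqnn n) C'e' e'i (ltnW ik)) (vE n' C' e' i nn' C'e' e'i (ltnW ik)).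
  apply: IH e'i ik; exact: sub'.
have hu C' i e' : in_box (y :: C') e' -> (e' + i < n)%N -> (i < k)%N ->
   (u n (map (to_site n) C'))`_i = (u n' (map (to_site n') C'))`_i.
  move=> C'e' e'i ik; rewrite (uE n C' e' i (leqnn n) C'e' e'i (ltnW ik)) (uE n' C' e' i nn' C'e' e'i (ltnW ik)).
  apply: IH e'i ik; exact: sub.
have stab1 := @spin_ops_stable _ _ (to_site n) (to_site n') (fun B => v n B - u n B)
  (fun B => v n' B - u n' B) 1 y (steps y) n k (fun z zs => zs) _ C e Ce ek.
have stab2 := @spin_ops_stable _ _ (to_site n) (to_site n') (fun B => v n B + u n B)
  (fun B => v n' B + u n' B) (-1) y (steps y) n k (fun z zs => zs) _ C e Ce ek.
have {}stab1 := stab1 (fun C' i e' c d f => etrans (coefB _ _ _)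
  (etrans (congr2 (fun a b => a - b) (hv C' i e' c d f) (hu C' i e' c d f)) (esym (coefB _ _ _)))).
have {}stab2 := stab2 (fun C' i e' c d f => etrans (coefD _ _ _)
  (etrans (congr2 (fun a b => a + b) (hv C' i e' c d f) (hu C' i e' c d f)) (esym (coefD _ _ _)))).
have CE : [seq x <- C | x != y] = C.
  by apply/all_filterP/allP => z zC; apply: contraNneq yC => <-.
rewrite -CE -(uE n C e k)// -(uE n' C e k)//.
(* The two composites are equal by [rel], so that -(v - u) + (v + u) = 2 u remains. The two
   differences on the left involve only orders below [k], where both lattices agree. *)
have key N : (2 < N)%N ->
    ((spin_ops 1 (map (to_site N) (steps y)) (fun B => v N B - u N B) (map (to_site N) C))`_k
      - (v N (map (to_site N) C) - u N (map (to_site N) C))`_k) -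
    ((spin_ops (-1) (map (to_site N) (steps y)) (fun B => v N B + u N B) (map (to_site N) C))`_k
      - (v N (map (to_site N) C) + u N (map (to_site N) C))`_k) =
    2 * (u N (map (to_site N) C))`_k.
  by move=> N2; rewrite rel// coefB coefD; ring.
have n'2 : (2 < n')%N by lia.
apply: (mulfI (x := 2)); first by rewrite pnatr_eq0.
by rewrite -!key// stab1 stab2.
Qed.

Lemma lattice_coef_stable n n' k C e : (n <= n')%N -> in_box C e -> (e + k < n)%N ->
  lattice_coef n C k = lattice_coef n' C k.
Proof.
move=> nn'; elim/ltn_ind: k C e => k IHk C e.
have [N CN] := ubnP (size C); elim: N C CN => // N IHN [|y C] CN Ce ek.
  by rewrite /lattice_coef !corr_coef_nil.
have inj n1 : (n <= n1)%N -> {in y :: C &, injective (to_site n1)}.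
  by move=> n1n; apply: in_box_inj Ce _; lia.
pose C1 := [seq x <- C | x != y].
have C1e : in_box (y :: C1) e.
  apply: in_box_sub Ce => z; rewrite !inE mem_filter => /orP[->//|/andP[_ ->]].
  by rewrite orbT.
have red n1 : (n <= n1)%N -> lattice_coef n1 (y :: C) k =
    lattice_coef n1 (if ~~ odd (count_mem y C) then y :: C1 else C1) k.
  move=> n1n; rewrite /lattice_coef.
  rewrite (corr_coef_eq (neighbor_pairs n1) (reduce_character F (to_site n1 y) (map (to_site n1) (y :: C)))) /= eqxx /=.
  rewrite (filter_to_site Ce); last by lia.
  rewrite count_map (_ : count _ C = count_mem y C); first by case: odd.
  apply: eq_in_count => x xC /=; apply/eqP/eqP => [/(inj _ n1n)|->//].
  by rewrite mem_head inE xC orbT; apply.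
rewrite !red//; case: ifP => _; last first.
  apply: IHN => //; first by rewrite size_filter (leq_ltn_trans (count_size _ _)).
  by apply: in_box_sub C1e => z zC1; rewrite inE zC1 orbT.
move=> {IHN}; have yC1 : y \notin C1 by rewrite mem_filter eqxx.
have notin n1 : (n <= n1)%N -> to_site n1 y \notin map (to_site n1) C1.
  by move=> n1n; apply: map_cons_notin C1e _ yC1; lia.
(* The cases e = 0, where only the spin at [y] is left, and k = 0 are settled separately: 2 < n
   follows from e + k < n once both are at least 1. *)
case: e => [|e] in Ce C1e ek *.
  have -> : C1 = [::].
    case E1: C1 => [//|z s]; move: C1e yC1; rewrite E1 => -[lo h] yC1.
    suff zy : z = y by rewrite zy mem_head in yC1.
    apply/ffunP => c; have := h y (mem_head _ _) c.
    have := h z _ c; rewrite !inE eqxx orbT => /(_ isT).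
    by rewrite !addr0 => /le_anti <- /le_anti.
  by rewrite /lattice_coef /= !(corr_coef_single F (@card_neighbor_pair _)).
case: k => [|k] in IHk red ek *.
  by rewrite /lattice_coef /= !corr_coef_order0// notin.
have n2 : (2 < n)%N by rewrite (leq_trans _ ek)// addSn addnS.
apply: (lattice_coef_stable_step n2 nn' yC1 C1e ek) => C' i e' C'e' e'i ik.
exact: IHk ik _ _ C'e' e'i.
Qed.

End Stability.
Local Open Scope complex_scope.

(** * Norms of polynomials and convergence of complex series *)

Section PolyNorm.
Variable F : numFieldType.
Implicit Types (p q : {poly F}) (x z : F).

Definition poly_norm x p : F := \sum_(k < size p) `|p`_k| * x ^+ k.

Lemma poly_normE n x p : (size p <= n)%N -> poly_norm x p = \sum_(k < n) `|p`_k| * x ^+ k.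
Proof.
move=> pn; rewrite /poly_norm (big_ord_widen n (fun k => `|p`_k| * x ^+ k) pn) big_mkcond.
by apply: eq_bigr => k _ /=; case: ltnP => // kp; rewrite nth_default// normr0 mul0r.
Qed.

Lemma poly_norm_ge0 x p : 0 <= x -> 0 <= poly_norm x p.
Proof. by move=> x0; apply: sumr_ge0 => k _; rewrite mulr_ge0 ?exprn_ge0. Qed.

Lemma poly_normD x p q : 0 <= x -> poly_norm x (p + q) <= poly_norm x p + poly_norm x q.
Proof.
move=> x0; pose n := maxn (size p) (size q).
rewrite (poly_normE (n := n) _ (size_polyD _ _)) (@poly_normE n) ?leq_maxl// (@poly_normE n x q) ?leq_maxr//.
rewrite -big_split; apply: ler_sum => k _ /=.
by rewrite -mulrDl coefD ler_wpM2r ?exprn_ge0// ler_normD.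
Qed.

Lemma poly_normN x p : poly_norm x (- p) = poly_norm x p.
Proof. by rewrite /poly_norm size_polyN; apply: eq_bigr => k _; rewrite coefN normrN. Qed.

Lemma poly_norm0 x : poly_norm x 0 = 0.
Proof. by rewrite /poly_norm size_poly0 big_ord0. Qed.

Lemma poly_norm_sum x n (p : 'I_n -> {poly F}) : 0 <= x ->
  poly_norm x (\sum_i p i) <= \sum_i poly_norm x (p i).
Proof.
move=> x0; elim/big_ind2: _ => [|a a' b b' h h'|//]; first by rewrite poly_norm0.
by rewrite (le_trans (poly_normD _ _ x0))// lerD.
Qed.

Lemma poly_norm_monomial x (c : F) k p : 0 <= x ->
  poly_norm x (c *: 'X^k * p) <= `|c| * x ^+ k * poly_norm x p.
Proof.
move=> x0; have sz : (size (c *: 'X^k * p)%R <= k + size p)%N.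
  rewrite -scalerAl (leq_trans (size_scale_leq _ _))//.
  by rewrite (leq_trans (size_polyMleq _ _))// size_polyXn addSn.
rewrite (poly_normE _ sz) big_split_ord /= big1 ?add0r; last first.
  by move=> i _; rewrite -scalerAl coefZ coefXnM ltn_ord mulr0 normr0 mul0r.
rewrite mulr_sumr; apply: ler_sum => i _; rewrite -scalerAl coefZ coefXnM.
by rewrite ltnNge leq_addr /= addKn normrM exprD le_eqVlt; apply/orP; left; apply/eqP; ring.
Qed.

Lemma poly_normM x p q : 0 <= x -> poly_norm x (p * q) <= poly_norm x p * poly_norm x q.
Proof.
move=> x0; rewrite -{1}[p]coefK poly_def mulr_suml mulr_suml.
by rewrite (le_trans (poly_norm_sum _ x0))//; apply: ler_sum => i _; exact: poly_norm_monomial.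
Qed.

Lemma poly_normX x p n : 0 <= x -> poly_norm x (p ^+ n) <= poly_norm x p ^+ n.
Proof.
move=> x0; elim: n => [|n IH].
  by rewrite !expr0 /poly_norm size_poly1 big_ord1 coef1 eqxx normr1 mulr1.
rewrite !exprS (le_trans (poly_normM _ _ x0))// ler_wpM2l ?poly_norm_ge0//.
Qed.

Lemma poly_norm_coef x p k : 0 <= x -> `|p`_k| * x ^+ k <= poly_norm x p.
Proof.
move=> x0; rewrite (@poly_normE (k.+1 + size p)) ?leq_addl//.
have kp : (k < k.+1 + size p)%N by rewrite addSn ltnS leq_addr.
rewrite (bigD1 (Ordinal kp))//= lerDl sumr_ge0// => i _.
by rewrite mulr_ge0 ?exprn_ge0.
Qed.

(** For k >= M, |z|^k is at most |z|^M r^(k - M). Applied to the difference of two expansions that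
    agree below order [M], this turns a formal identity into a limit as soon as the norms grow
    slower than (r / |z|)^M. *)
Lemma horner_tail (r z : F) p M : `|z| <= r -> (forall k, (k < M)%N -> p`_k = 0) ->
  `|p.[z]| * r ^+ M <= `|z| ^+ M * poly_norm r p.
Proof.
move=> zr p0; have r0 := le_trans (normr_ge0 z) zr.
rewrite horner_coef mulr_sumr (le_trans (ler_wpM2r _ (ler_norm_sum _ _ _))) ?exprn_ge0//.
rewrite mulr_suml; apply: ler_sum => k _; rewrite normrM normrX.
have [kM|Mk] := ltnP k M; first by rewrite p0// normr0 !mul0r mulr0.
rewrite mulrCA -mulrA ler_wpM2l// -(subnKC Mk) !exprD.
rewrite -mulrA ler_wpM2l ?exprn_ge0// mulrC ler_wpM2l ?exprn_ge0//.
by rewrite lerXn2r ?nnegrE.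
Qed.

Lemma poly_norm_poly r n (c : nat -> F) : poly_norm r (\poly_(k < n) c k) = \sum_(k < n) `|c k| * r ^+ k.
Proof. by rewrite (poly_normE _ (size_poly _ _)); apply: eq_bigr => k _; rewrite coef_poly ltn_ord. Qed.

End PolyNorm.

Local Open Scope classical_set_scope.

Section ComplexSeries.
Variable R : realType.
Local Notation C := R[i]^o.
Implicit Types (u : nat -> C) (z l : C).

Lemma norm_RRe (z : R[i]) : `|z| = (complex.Re `|z|)%:C.
Proof. by rewrite normc_def. Qed.

Lemma Re_norm_ge0 (z : R[i]) : 0 <= complex.Re `|z|.
Proof. by rewrite -ler0c -norm_RRe. Qed.

Lemma ge0_RRe (c : R[i]) : 0 <= c -> c = (complex.Re c)%:C.
Proof. by move=> c0; rewrite RRe_real// ger0_real. Qed.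

Lemma cvg_complexP u l : (u @ \oo --> l) <->
  (forall e : R, 0 < e -> exists N, forall n, (N <= n)%N -> `|l - u n| < e%:C).
Proof.
split=> [/cvgrPdist_lt ul e e0|ul].
  have := ul e%:C; rewrite ltcR => /(_ e0) [N _ h].
  by exists N => n Nn; exact: h.
apply/cvgrPdist_lt => e e0; have eE := ge0_RRe (ltW e0).
move: e0; rewrite eE ltcR => /ul[N h]; exists N => // n /= Nn; exact: h.
Qed.

Lemma cvg0_natP (w : nat -> R) : (w @ \oo --> (0 : R)) ->
  forall e : R, 0 < e -> exists N, forall n, (N <= n)%N -> w n < e.
Proof.
move=> /cvgrPdist_lt h e e0; have [N _ H] := h e e0; exists N => n Nn.
by have := H n Nn; rewrite /= sub0r normrN; apply: le_lt_trans; exact: ler_norm.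
Qed.

Lemma squeeze_complex u l (w : nat -> R) : (w @ \oo --> (0 : R)) ->
  (forall n, `|l - u n| <= (w n)%:C) -> u @ \oo --> l.
Proof.
move=> /cvg0_natP w0 ul; apply/cvg_complexP => e /w0[N h]; exists N => n /h we.
by rewrite (le_lt_trans (ul n))// ltcR.
Qed.

Lemma geometric0 (K y : R) : 0 <= y < 1 -> (fun n => K * y ^+ n) @ \oo --> (0 : R).
Proof. by move=> /andP[y0 y1]; apply: cvg_geometric; rewrite ger0_norm. Qed.

(** With s = sqrt y, (n + 1) s^n is at most the sum of s^i over i <= n, hence at most 1 / (1 - s);
    the other factor s^n is kept. This trades a linear factor in a coefficient bound for a slower
    geometric rate. *)
Lemma natmul_expr_le (y : R) n : 0 <= y < 1 ->
  n.+1%:R * y ^+ n <= (1 - Num.sqrt y)^-1 * Num.sqrt y ^+ n.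
Proof.
move=> /andP[y0 y1]; set s := Num.sqrt y.
have s0 : 0 <= s by rewrite sqrtr_ge0.
have s1 : s < 1 by rewrite /s -sqrtr1 ltr_sqrt.
rewrite -(sqr_sqrtr y0) -/s exprAC expr2 mulrA ler_wpM2r ?exprn_ge0//.
rewrite -[leRHS]mul1r ler_pdivlMr ?subr_gt0//.
have le : n.+1%:R * s ^+ n <= \sum_(i < n.+1) s ^+ i.
  rewrite mulr_natl -[in leLHS](card_ord n.+1) -sumr_const; apply: ler_sum => i _.
  by rewrite ler_wiXn2l ?(ltW s1)// -ltnS.
rewrite (le_trans (ler_wpM2r _ le)) ?subr_ge0 ?(ltW s1)//.
have := subrX1 s n.+1; move/(congr1 -%R); rewrite opprB -mulNr opprB mulrC => <-.
by rewrite lerBlDr lerDl exprn_ge0.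
Qed.

Lemma natmul_expr_cvg0 (K y : R) : 0 <= y < 1 -> (fun n => K * (n.+1%:R * y ^+ n)) @ \oo --> (0 : R).
Proof.
move=> y01; have /andP[y0 y1] := y01.
rewrite -[X in _ --> X](mulr0 K); apply: cvgM; first exact: cvg_cst.
apply: (@squeeze_cvgr _ _ _ _ (fun=> 0) (fun n => (1 - Num.sqrt y)^-1 * Num.sqrt y ^+ n)).
- by apply: nearW => n; rewrite natmul_expr_le// andbT mulr_ge0 ?exprn_ge0.
- exact: cvg_cst.
- by apply: geometric0; rewrite sqrtr_ge0 -sqrtr1 ltr_sqrt.
Qed.

(** Completeness is taken from [R] through real and imaginary parts; the geometric bound on
    differences of partial sums then passes to the limit. *)
Lemma complex_series_geometric (c : nat -> C) (K y : R) : 0 <= K -> 0 <= y < 1 ->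
  (forall k, `|c k| <= (K * y ^+ k)%:C) ->
  exists2 l : C, series c @ \oo --> l &
    forall M, `|l - series c M| <= (K / (1 - y) * y ^+ M)%:C.
Proof.
move=> K0 /andP[y0 y1] cK.
have cvgpart (f : R[i] -> R) : (forall z, `|f z|%:C <= `|z|) -> cvgn (series (fun k => f (c k))).
  move=> fz; apply: normed_cvg; apply: (@series_le_cvg _ _ (geometric K y)) => //.
  - by move=> n; exact: normr_ge0.
  - by move=> n; rewrite /= mulr_ge0 ?exprn_ge0.
  - by move=> n; rewrite /= -lecR (le_trans (fz _)).
  - by apply: is_cvg_geometric_series; rewrite ger0_norm.
have imz (z : R[i]) : `|complex.Im z|%:C <= `|z|.
  rewrite normc_def lecR -sqrtr_sqr ler_sqrt ?lerDr ?sqr_ge0//.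
  by rewrite addr_ge0 ?sqr_ge0.
have cre := cvgpart _ (@normc_ge_Re R); have cim := cvgpart _ imz.
pose l : C := (limn (series (fun k => complex.Re (c k)))) +i* (limn (series (fun k => complex.Im (c k)))).
have seriesE M : series c M = (series (fun k => complex.Re (c k)) M) +i* (series (fun k => complex.Im (c k)) M).
  rewrite /series /=; elim: M => [|M IH]; first by rewrite !big_geq.
  by rewrite !big_nat_recr//= IH; case: (c M) => a b.
have cl : series c @ \oo --> l.
  apply/cvg_complexP => e e0; have e20 : 0 < e / 2 by rewrite divr_gt0.
  have /cvgrPdist_lt/(_ _ e20)[N1 _ h1] := cre; have /cvgrPdist_lt/(_ _ e20)[N2 _ h2] := cim.
  exists (maxn N1 N2) => n; rewrite geq_max => /andP[/h1 /= {}h1 /h2 /= {}h2].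
  rewrite seriesE /l.
  set a := limn _ in h1 *; set b := limn _ in h2 *.
  have -> : (a +i* b)%C - ((series (fun k => complex.Re (c k)) n) +i* (series (fun k => complex.Im (c k)) n))%C =
    (a - series (fun k => complex.Re (c k)) n)%:C + 'i%C * (b - series (fun k => complex.Im (c k)) n)%:C.
    by apply/eqP; rewrite eq_complex /=; apply/andP; split; apply/eqP; ring.
  rewrite (le_lt_trans (ler_normD _ _))// normrM !normc_def /= expr0n expr1n /= add0r sqrtr1 mul1r !addr0 !sqrtr_sqr.
  by rewrite -rmorphD ltcR (splitr e) ltrD.
exists l => // M.
have tail n : (M <= n)%N -> `|series c n - series c M| <= (K / (1 - y) * y ^+ M)%:C.
  move=> Mn; rewrite sub_series_geq// (le_trans (ler_norm_sum _ _ _))//.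
  apply: (@le_trans _ _ ((\sum_(M <= i < n) K * y ^+ i)%:C)).
    by rewrite rmorph_sum; apply: ler_sum => i _; exact: cK.
  rewrite lecR -mulr_sumr -mulrA ler_wpM2l// mulrC ler_pdivlMr ?subr_gt0//.
  rewrite -(subnKC Mn) geometric_partial_tail geometric_seriesE ?lt_eqF//.
  rewrite divfK ?subr_eq0 ?gt_eqF// ler_piMr ?exprn_ge0//.
  by rewrite lerBlDr lerDl exprn_ge0.
have h (e : R) : 0 < e -> `|l - series c M| <= (K / (1 - y) * y ^+ M)%:C + e%:C.
  move=> e0; have /cvg_complexP/(_ e e0)[N hN] := cl.
  have -> : l - series c M = (l - series c (maxn M N)) + (series c (maxn M N) - series c M) by rewrite addrA subrK.
  rewrite (le_trans (ler_normD _ _))// addrC lerD ?tail ?leq_maxl//.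
  by apply/ltW/hN/leq_maxr.
rewrite norm_RRe lecR; apply/ler_addgt0Pr => e /h.
by rewrite norm_RRe -rmorphD lecR.
Qed.

(* Stated without division, because Z.[z] != 0 is itself deduced from it. *)
Lemma quotient_series (a : nat -> C) (Z p : {poly C}) (r : R) z :
  0 < r -> (forall k, `|a k| * r%:C ^+ k <= 1) ->
  (forall M k, (k < M)%N -> (Z * \poly_(i < M) a i)`_k = p`_k) ->
  `|z| < r%:C ->
  (fun M => Z.[z] * series (fun k => a k * z ^+ k) M) @ \oo --> (p.[z] : C).
Proof.
move=> r0 ar Zap zr; have rC : 0 <= r%:C :> R[i] by rewrite ler0c ltW.
pose y := complex.Re `|z| / r; have y01 : 0 <= y < 1.
  rewrite divr_ge0 ?Re_norm_ge0 ?(ltW r0)//= ltr_pdivrMr// mul1r.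
  by rewrite -ltcR -norm_RRe.
pose K := complex.Re (poly_norm r%:C Z) + complex.Re (poly_norm r%:C p).
have ZE := ge0_RRe (poly_norm_ge0 Z rC); have pE := ge0_RRe (poly_norm_ge0 p rC).
apply: (squeeze_complex (natmul_expr_cvg0 K y01)) => M.
have -> : series (fun k => a k * z ^+ k) M = (\poly_(i < M) a i).[z].
  by rewrite horner_poly /series /= big_mkord.
rewrite -normrN opprB -hornerM -hornerN -hornerD.
have H := horner_tail (ltW zr) (p := Z * \poly_(i < M) a i - p) (M := M).
have {}H := H (fun k kM => etrans (coefB _ _ _) (etrans (congr1 (fun c => c - p`_k) (Zap M k kM)) (subrr _))).
(* By [ar] each coefficient adds at most 1 to the norm of the truncated series, so the norm grows
   only linearly in [M] and loses against y^M. *)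
have nM : poly_norm r%:C (Z * \poly_(i < M) a i - p) <= (K * M.+1%:R)%:C.
  rewrite (le_trans (poly_normD _ _ rC))// poly_normN.
  have aM : poly_norm r%:C (\poly_(i < M) a i) <= M%:R.
    rewrite poly_norm_poly -[in leRHS](card_ord M) -sumr_const; apply: ler_sum => i _; exact: ar.
  rewrite (le_trans (lerD (le_trans (poly_normM _ _ rC) (ler_wpM2l (poly_norm_ge0 _ rC) aM)) (lexx _)))//.
  rewrite /K rmorphM rmorphD /= -ZE -pE rmorph_nat mulrDl lerD//.
    by rewrite ler_wpM2l ?poly_norm_ge0// ler_nat.
  by rewrite ler_peMr ?poly_norm_ge0// ler1n.
have {}H := le_trans H (ler_wpM2l (exprn_ge0 _ (normr_ge0 z)) nM).
rewrite -(ler_pM2r (x := r%:C ^+ M)) ?exprn_gt0 ?ltcR//.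
apply: le_trans H _; rewrite {1}norm_RRe -!rmorphXn -!rmorphM lecR /y expr_div_n.
rewrite le_eqVlt; apply/orP; left; apply/eqP; field.
by rewrite expf_eq0 (gt_eqF r0) andbF.
Qed.

End ComplexSeries.

(** * Exponential series *)

Section ExpSeries.
Variable R : realType.
Local Notation C := R[i]^o.

Definition exp_poly (w : C) M : {poly C} := \poly_(k < M) (w ^+ k / k`!%:R).

Lemma horner_exp_poly w M : (exp_poly w M).[1] = series (fun k => w ^+ k / k`!%:R) M.
Proof.
rewrite horner_poly /series /= big_mkord; apply: eq_bigr => k _.
by rewrite expr1n mulr1.
Qed.

Lemma exp_partial_le (x : R) M : 0 <= x -> \sum_(k < M) x ^+ k / k`!%:R <= expR x.
Proof.
move=> x0; have := is_cvg_series_exp_coeff x => cx.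
have nd : nondecreasing_seq (series (exp_coeff x)).
  by apply: nondecreasing_series => n _ _; rewrite exp_coeff_ge0.
by have := nondecreasing_cvgn_le nd cx M; rewrite /series /= big_mkord.
Qed.

Lemma poly_norm_exp (w : C) (x : R) M : 0 <= x ->
  poly_norm x%:C (exp_poly w M) <= (expR (complex.Re `|w| * x))%:C.
Proof.
move=> x0; rewrite poly_norm_poly.
apply: (@le_trans _ _ ((\sum_(k < M) (complex.Re `|w| * x) ^+ k / k`!%:R)%:C)); last first.
  by rewrite lecR exp_partial_le// mulr_ge0 ?Re_norm_ge0.
rewrite rmorph_sum le_eqVlt; apply/orP; left; apply/eqP; apply: eq_bigr => k _ /=.
rewrite normrM normrX normfV normr_nat norm_RRe /= rmorphM fmorphV rmorphXn rmorphM rmorph_nat exprMn.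
by rewrite mulrAC.
Qed.

Lemma coef_exp_polyM (u w : C) M k : (k < M)%N ->
  (exp_poly u M * exp_poly w M)`_k = (exp_poly (u + w) M)`_k.
Proof.
move=> kM; rewrite coefM coef_poly kM addrC exprDn mulr_suml; apply: eq_bigr => -[i /= ik] _.
rewrite ltnS in ik.
rewrite !coef_poly (leq_ltn_trans ik kM) (leq_ltn_trans (leq_subr _ _) kM).
have f0 n : n`!%:R != 0 :> R[i] by rewrite pnatr_eq0 -lt0n fact_gt0.
have -> : k`!%:R = 'C(k, i)%:R * (i`!%:R * (k - i)`!%:R) :> R[i].
  by rewrite -!natrM bin_fact.
have b0 : 'C(k, i)%:R != 0 :> R[i] by rewrite pnatr_eq0 -lt0n bin_gt0.
by rewrite -[(_ * _) *+ _]mulr_natr; field; rewrite b0 !f0.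
Qed.

(** [exp_poly w M] truncates exp (w X), to be evaluated at X = 1. The product for [u] and [w] agrees
    below order [M] with the polynomial for u + w, and all norms at radius 2 are bounded in [M], so
    the values at 1 differ by O(2^-M). The radius 2 stands for any radius above 1. *)
Lemma exp_series_mul (u w lu lw : C) :
  series (fun k => u ^+ k / k`!%:R) @ \oo --> lu ->
  series (fun k => w ^+ k / k`!%:R) @ \oo --> lw ->
  series (fun k => (u + w) ^+ k / k`!%:R) @ \oo --> (lu * lw : C).
Proof.
move=> clu clw.
have R2 : 0 <= (2 : R)%:C :> R[i] by rewrite ler0c.
pose D M := exp_poly u M * exp_poly w M - exp_poly (u + w) M.
pose K := expR (complex.Re `|u| * 2) * expR (complex.Re `|w| * 2) + expR (complex.Re `|u + w| * 2).
have D0 : (fun M => (D M).[1] : C) @ \oo --> (0 : C).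
  have y01 : 0 <= (2^-1 : R) < 1 by lra.
  apply: (squeeze_complex (geometric0 K y01)) => M; rewrite sub0r normrN.
  have n1 : `|1| <= (2 : R)%:C :> R[i] by rewrite normr1 -[1]/((1:R)%:C) lecR; lra.
  have := horner_tail n1 (p := D M) (M := M).
  move=> /(_ (fun k kM => etrans (coefB _ _ _) (etrans (congr1 (fun c => c - _) (coef_exp_polyM u w kM)) (subrr _)))).
  rewrite normr1 expr1n mul1r => h.
  rewrite -(ler_pM2r (x := (2 : R)%:C ^+ M)) ?exprn_gt0 ?ltcR//.
  have -> : (K * 2^-1 ^+ M)%:C * (2 : R)%:C ^+ M = K%:C :> R[i].
    by rewrite -rmorphXn -rmorphM -mulrA -exprMn mulVf// expr1n mulr1.
  rewrite (le_trans h)// (le_trans (poly_normD _ _ R2))// poly_normN /K (rmorphD _ (_ * _)) (rmorphM _ (expR _)).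
  rewrite lerD ?poly_norm_exp//.
  by rewrite (le_trans (poly_normM _ _ R2))// ler_pM ?poly_norm_ge0 ?poly_norm_exp.
have -> : series (fun k => (u + w) ^+ k / k`!%:R) =
   (fun M => series (fun k => u ^+ k / k`!%:R) M * series (fun k => w ^+ k / k`!%:R) M - (D M).[1]).
  apply: funext => M; by rewrite /D hornerD hornerN hornerM -!horner_exp_poly subKr.
by rewrite -[lu * lw]subr0; exact: (cvgB (cvgM clu clw) D0).
Qed.

Lemma cvg_real_complex (w : nat -> R) (l : R) : (w @ \oo --> l) ->
  (fun n => (w n)%:C : C) @ \oo --> (l%:C : C).
Proof.
move=> /cvgrPdist_lt wl; apply/cvg_complexP => e /wl[N _ h]; exists N => n /h /=.
by rewrite -rmorphB normc_def /= expr0n addr0 sqrtr_sqr ltcR.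
Qed.

Lemma series_complex (w : nat -> R) M : series (fun k => (w k)%:C : C) M = (series w M)%:C.
Proof. by rewrite /series /= rmorph_sum. Qed.

Lemma exp_series_real (x : R) : series (fun k => (x%:C : C) ^+ k / k`!%:R) @ \oo --> ((expR x)%:C : C).
Proof.
have -> : series (fun k => (x%:C : C) ^+ k / k`!%:R) = (fun M => (series (exp_coeff x) M)%:C : C).
  apply: funext => M; rewrite -series_complex; congr (series _ M); apply: funext => k.
  by rewrite /exp_coeff /= rmorphM fmorphV rmorphXn rmorph_nat.
by apply: cvg_real_complex; exact: is_cvg_series_exp_coeff.
Qed.

Lemma exp_series_imag (y : R) :
  series (fun k => ('i%C * y%:C : C) ^+ k / k`!%:R) @ \oo --> ((cos y)%:C + 'i%C * (sin y)%:C : C).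
Proof.
have -> : series (fun k => ('i%C * y%:C : C) ^+ k / k`!%:R) =
   (fun M => (series (cos_coeff y) M)%:C + 'i%C * (series (sin_coeff y) M)%:C : C).
  apply: funext => M; rewrite -!series_complex /series /= mulr_sumr -big_split; apply: eq_bigr => k _ /=.
  rewrite /cos_coeff /sin_coeff /= exprMn !rmorphM !fmorphV !rmorphXn !rmorph_nat !rmorphN1.
  have -> : 'i%C ^+ k = (~~ odd k)%:R * (-1) ^+ k./2 + 'i%C * ((odd k)%:R * (-1) ^+ k.-1./2) :> R[i].
    rewrite -{1}[k]odd_double_half -mul2n exprD exprM sqr_i.
    case ok: (odd k); rewrite /= ?expr0 ?expr1 ?mul0r ?mul1r ?mulr0 ?addr0 ?add0r//.
    by congr (_ * _ ^+ _); case: k ok => //= k /negbTE; lia.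
  ring.
apply: cvgD; first by apply: cvg_real_complex; rewrite unlock; exact: is_cvg_series_cos_coeff.
apply: cvgM; first exact: cvg_cst.
by apply: cvg_real_complex; rewrite unlock; exact: is_cvg_series_sin_coeff.
Qed.

Lemma cexp_series (z : C) : series (fun k => z ^+ k / k`!%:R) @ \oo --> cexp z.
Proof.
rewrite {1}[z]complexE.
have -> : cexp z = (expR (complex.Re z))%:C * ((cos (complex.Im z))%:C + 'i%C * (sin (complex.Im z))%:C).
  rewrite /cexp; apply/eqP; rewrite eq_complex /=; apply/andP; split; apply/eqP; ring.
by apply: exp_series_mul; [exact: exp_series_real | exact: exp_series_imag].
Qed.

Lemma cexpD (z w : C) : cexp (z + w) = cexp z * cexp w.
Proof.
case: z w => a b [c d]; rewrite /cexp /= expRD cosD sinD.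
by apply/eqP; rewrite eq_complex /=; apply/andP; split; apply/eqP; ring.
Qed.

Lemma cexp0 : cexp (0 : C) = 1.
Proof. by rewrite /cexp /= expR0 cos0 sin0 mulr1 mulr0. Qed.

Lemma cexp_neq0 (z : C) : cexp z != 0.
Proof.
apply/eqP => z0; have := cexpD z (- z); rewrite subrr cexp0 z0 mul0r => /eqP.
by rewrite oner_eq0.
Qed.

Definition cosh_coef (k : nat) : R := (~~ odd k)%:R / k`!%:R.
Definition sinh_coef (k : nat) : R := (odd k)%:R / k`!%:R.

Lemma cosh_series z : series (fun k => (cosh_coef k)%:C * z ^+ k : C) @ \oo --> ccosh z.
Proof.
have -> : series (fun k => (cosh_coef k)%:C * z ^+ k : C) =
   (fun M => (series (fun k => z ^+ k / k`!%:R) M + series (fun k => (- z) ^+ k / k`!%:R) M) * 2^-1).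
  apply: funext => M; rewrite /series /= -big_split mulr_suml; apply: eq_bigr => k _ /=.
  rewrite /cosh_coef rmorphM fmorphV !rmorph_nat exprNn -signr_odd.
  by case: odd; rewrite /= ?expr0 ?expr1; field; rewrite pnatr_eq0 -lt0n fact_gt0.
by apply: cvgM; [apply: cvgD; exact: cexp_series | exact: cvg_cst].
Qed.

Lemma sinh_series z : series (fun k => (sinh_coef k)%:C * z ^+ k : C) @ \oo --> csinh z.
Proof.
have -> : series (fun k => (sinh_coef k)%:C * z ^+ k : C) =
   (fun M => (series (fun k => z ^+ k / k`!%:R) M - series (fun k => (- z) ^+ k / k`!%:R) M) * 2^-1).
  apply: funext => M; rewrite /series /= -sumrB mulr_suml; apply: eq_bigr => k _ /=.
  rewrite /sinh_coef rmorphM fmorphV !rmorph_nat exprNn -signr_odd.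
  by case: odd; rewrite /= ?expr0 ?expr1; field; rewrite pnatr_eq0 -lt0n fact_gt0.
by apply: cvgM; [apply: cvgB; exact: cexp_series | exact: cvg_cst].
Qed.

End ExpSeries.

(** * Hyperbolic tangent *)

Section TanhSeries.
Variable R : realType.
Local Notation C := R[i]^o.

(* The recursion is the differential equation tanh' = 1 - tanh^2. *)
Definition tanh_next (s : seq R) : R :=
  if size s is k.+1 then ((k == 0)%:R - \sum_(i < k.+1) s`_i * s`_(k - i)) / k.+1%:R else 0.

Fixpoint tanh_seq n : seq R :=
  if n is m.+1 then rcons (tanh_seq m) (tanh_next (tanh_seq m)) else [::].

Definition tanh_coef k : R := (tanh_seq k.+1)`_k.

Lemma size_tanh_seq n : size (tanh_seq n) = n.
Proof. by elim: n => //= n IH; rewrite size_rcons IH. Qed.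

Lemma nth_tanh_seq n k : (k < n)%N -> (tanh_seq n)`_k = tanh_coef k.
Proof.
elim: n => // n IH; rewrite ltnS leq_eqVlt => /orP[/eqP ->//|kn].
by rewrite /= nth_rcons size_tanh_seq kn IH.
Qed.

Lemma tanh_coef0 : tanh_coef 0 = 0.
Proof. by []. Qed.

Lemma tanh_coefS k : k.+1%:R * tanh_coef k.+1 =
  (k == 0)%:R - \sum_(i < k.+1) tanh_coef i * tanh_coef (k - i).
Proof.
rewrite {1}/tanh_coef [tanh_seq _]/= nth_rcons size_rcons size_tanh_seq ltnn eqxx.
rewrite -/(tanh_seq k.+1) {1}/tanh_next size_tanh_seq mulrC divfK ?pnatr_eq0//.
congr (_ - _); apply: eq_bigr => -[i /= ik] _.
by rewrite -/(tanh_seq k.+1) !nth_tanh_seq// ltnS leq_subr.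
Qed.

Definition tanh_poly M : {poly R} := \poly_(k < M) tanh_coef k.
Definition cosh_poly M : {poly R} := \poly_(k < M) cosh_coef R k.
Definition sinh_poly M : {poly R} := \poly_(k < M) sinh_coef R k.

Lemma cosh_coefS k : k.+1%:R * cosh_coef R k.+1 = sinh_coef R k.
Proof.
by rewrite /cosh_coef /sinh_coef /= negbK factS natrM invfM mulrCA mulVKf// pnatr_eq0.
Qed.

Lemma sinh_coefS k : k.+1%:R * sinh_coef R k.+1 = cosh_coef R k.
Proof.
by rewrite /cosh_coef /sinh_coef /= factS natrM invfM mulrCA mulVKf// pnatr_eq0.
Qed.

(* D = tanh cosh - sinh satisfies D' = - tanh D and vanishes at 0. *)
Lemma tanh_cosh_sinh M k : (k < M)%N -> (tanh_poly M * cosh_poly M - sinh_poly M)`_k = 0.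
Proof.
set D := _ - _; elim/ltn_ind: k => -[_ M0|k IH kM].
  rewrite /D coefB coefM big_ord1 !coef_poly M0 tanh_coef0 mul0r.
  by rewrite /sinh_coef /= mul0r subrr.
have : (D^`())`_k = (- (tanh_poly M * D))`_k.
  transitivity (((1 - tanh_poly M * tanh_poly M) * cosh_poly M + tanh_poly M * sinh_poly M - cosh_poly M)`_k).
    rewrite /D derivB derivM coefB [in RHS]coefB !coefD; congr (_ + _ - _).
    - apply: coefM_eq => // i ik; have iM : (i < M)%N by lia.
      have i1M : (i.+1 < M)%N by lia.
      rewrite coef_deriv coef_poly i1M -mulr_natl tanh_coefS coefB coef1 coefM; congr (_ - _).
      apply: eq_bigr => -[a /= ai] _; rewrite ltnS in ai; rewrite !coef_poly.
      by rewrite (leq_ltn_trans ai iM) (leq_ltn_trans (leq_subr _ _) iM).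
    - apply: coefM_eq => // i ik.
      have i1M : (i.+1 < M)%N by lia.
      by rewrite coef_deriv !coef_poly i1M (ltnW i1M) -mulr_natl cosh_coefS.
    - by rewrite coef_deriv !coef_poly kM (ltnW kM) -mulr_natl sinh_coefS.
  by apply: (congr1 (fun p : {poly R} => p`_k)); rewrite /D; ring.
rewrite coef_deriv coefN coefM big1 ?oppr0 => [|[i /= ik] _].
  by move/eqP; rewrite mulrn_eq0 /= => /eqP.
rewrite ltnS in ik.
have [->|i0] := posnP i; first by rewrite coef_poly tanh_coef0 if_same mul0r.
by rewrite IH ?mulr0//; lia.
Qed.

Lemma derivative_le0 (f df : R -> R) (a : R) : 0 <= a ->
  (forall x : R, is_derive x (1 : R) f (df x)) -> (forall x, 0 <= x -> df x <= 0) -> f a <= f 0.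
Proof.
move=> a0 fd dfle.
apply: (@ler0_derive1_le_cc _ f 0 a) => //; rewrite ?in_itv /= ?lexx ?a0//.
- move=> x; rewrite in_itv /= => /andP[/ltW x0 _].
  by rewrite derive1E derive_val dfle.
- apply: derivable_within_continuous => x _; exact: ex_derive.
Qed.

(* The partial sums g of sum_k |tanh_coef k| x^k satisfy g' <= 1 + g^2, hence
   stay below the solution tan of the equality case. *)
Lemma tanh_majorant (r : R) M : 0 <= r ->
  \sum_(k < M) `|tanh_coef k| * atan r ^+ k <= r.
Proof.
move=> r0; have ar0 : 0 <= atan r by rewrite -atan0 le_atan.
pose g : {poly R} := \poly_(k < M) `|tanh_coef k|.
have gE x : g.[x] = \sum_(k < M) `|tanh_coef k| * x ^+ k by rewrite horner_poly.
rewrite -gE leNgt; apply/negP => /lt_atan; apply/negP; rewrite -leNgt.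
have g_ge0 k : 0 <= g`_k by rewrite coef_poly; case: ifP.
have dg x : 0 <= x -> g^`().[x] <= 1 + g.[x] ^+ 2.
  move=> x0; have -> : 1 + g.[x] ^+ 2 = (1 + g ^+ 2).[x] by rewrite hornerD hornerC -horner_exp.
  have co k : (g^`())`_k <= (1 + g ^+ 2)`_k.
    rewrite coef_deriv coefD coef1 expr2 coefM coef_poly; case: ltnP => kM; last first.
      by rewrite mul0rn addr_ge0// sumr_ge0// => i _; rewrite mulr_ge0.
    have -> : `|tanh_coef k.+1| *+ k.+1 = `|k.+1%:R * tanh_coef k.+1|.
      by rewrite normrM normr_nat mulr_natl.
    rewrite tanh_coefS.
    rewrite (le_trans (ler_normB _ _))// normr_nat lerD// (le_trans (ler_norm_sum _ _ _))//.
    apply: ler_sum => -[i /= ik] _; rewrite normrM !coef_poly.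
    rewrite ltnS in ik; by rewrite (leq_ltn_trans ik (ltnW kM)) (leq_ltn_trans (leq_subr _ _) (ltnW kM)).
  have h2 (p q : {poly R}) : (forall k, p`_k <= q`_k) -> p.[x] <= q.[x].
    move=> pq; rewrite (@horner_coef_wide _ (maxn (size p) (size q)) p) ?leq_maxl//.
    rewrite (@horner_coef_wide _ (maxn (size p) (size q)) q) ?leq_maxr//.
    by apply: ler_sum => i _; rewrite ler_wpM2r ?exprn_ge0.
  exact: h2.
(* Dividing g' <= 1 + g^2 by 1 + g^2 shows that this function does not increase. Comparing
   arctangents instead of tangents avoids the poles of tan. *)
pose f x := atan g.[x] - x.
have fd x : is_derive x (1 : R) f ((1 + g.[x] ^+ 2)^-1 * g^`().[x] - 1).
  apply: is_deriveB.
have := derivative_le0 ar0 fd.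
rewrite /f horner_coef0 coef_poly tanh_coef0 normr0 if_same atan0 subr0 => h.
rewrite -subr_le0; apply: h => x x0.
rewrite subr_le0 mulrC ler_pdivrMr ?mul1r ?dg//.
by rewrite ltr_pwDl// sqr_ge0.
Qed.

(** If t is the sum of the tanh series, the formal identity gives t cosh z = sinh z. A zero of cosh
    would thus be a zero of sinh, hence of exp = cosh + sinh, which has none. *)
Lemma tanh_series (r : R) (z : C) : 0 < r -> `|z| < (atan r)%:C ->
  ccosh z != 0 /\ series (fun k => (tanh_coef k)%:C * z ^+ k : C) @ \oo --> ctanh z.
Proof.
move=> r0 zr; set rho := atan r.
have rho0 : 0 < rho by rewrite /rho -(@atan0 R) lt_atan.
have rhoC : 0 <= rho%:C :> R[i] by rewrite ler0c ltW.
pose y := complex.Re `|z| / rho; have y01 : 0 <= y < 1.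
  rewrite divr_ge0 ?Re_norm_ge0 ?(ltW rho0)//= ltr_pdivrMr// mul1r.
  by rewrite -ltcR -norm_RRe.
have zE : `|z| = (y * rho)%:C by rewrite /y divfK ?gt_eqF// -norm_RRe.
clearbody y.
have tb k : `|tanh_coef k| * rho ^+ k <= r.
  apply: le_trans (tanh_majorant k.+1 (ltW r0)); rewrite big_ord_recr /= lerDr sumr_ge0// => i _.
  by rewrite mulr_ge0 ?exprn_ge0 ?(ltW rho0).
have [|t ct _] := complex_series_geometric (c := fun k => (tanh_coef k)%:C * z ^+ k) (ltW r0) y01.
  move=> k; rewrite normrM normrX zE normc_def /= expr0n addr0 sqrtr_sqr -rmorphXn -rmorphM lecR.
  by rewrite exprMn mulrCA mulrC ler_wpM2r ?exprn_ge0//; case/andP: y01.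
pose toC := map_poly (real_complex R).
pose D M : {poly C} := toC (tanh_poly M * cosh_poly M - sinh_poly M).
have DE M : (D M).[z] = series (fun k => (tanh_coef k)%:C * z ^+ k : C) M *
   series (fun k => (cosh_coef R k)%:C * z ^+ k : C) M - series (fun k => (sinh_coef R k)%:C * z ^+ k : C) M.
  have sE (c : nat -> R) : series (fun k => (c k)%:C * z ^+ k : C) M = (toC (\poly_(k < M) c k)).[z].
    rewrite /toC (@horner_coef_wide _ M); last by rewrite size_map_poly size_poly.
    rewrite /series /= big_mkord; apply: eq_bigr => k _.
    by rewrite coef_map coef_poly ltn_ord.
  by rewrite !sE /D /toC rmorphB rmorphM hornerD hornerN hornerM.
have nrm (c : nat -> R) M : poly_norm rho%:C (toC (\poly_(k < M) c k)) = (\sum_(k < M) `|c k| * rho ^+ k)%:C.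
  rewrite (@poly_normE _ M); last by rewrite size_map_poly size_poly.
  rewrite rmorph_sum; apply: eq_bigr => k _.
  by rewrite coef_map coef_poly ltn_ord normc_def /= expr0n addr0 sqrtr_sqr -rmorphXn -rmorphM.
have expb (c : nat -> R) M : (forall k, `|c k| <= k`!%:R^-1) -> \sum_(k < M) `|c k| * rho ^+ k <= expR rho.
  move=> ck; apply: le_trans (exp_partial_le M (ltW rho0)); apply: ler_sum => k _.
  by rewrite mulrC ler_wpM2l// exprn_ge0// ltW.
have cc k : `|cosh_coef R k| <= k`!%:R^-1.
  rewrite /cosh_coef normrM normfV !normr_nat ler_piMl ?invr_ge0//.
  by case: odd.
have ss k : `|sinh_coef R k| <= k`!%:R^-1.
  rewrite /sinh_coef normrM normfV !normr_nat ler_piMl ?invr_ge0//.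
  by case: odd.
have D0 : (fun M => (D M).[z] : C) @ \oo --> (0 : C).
  apply: (squeeze_complex (geometric0 (r * expR rho + expR rho) y01)) => M; rewrite sub0r normrN.
  have := horner_tail (ltW zr) (p := D M) (M := M).
  move=> /(_ (fun k kM => etrans (coef_map _ _ _) (etrans (congr1 _ (tanh_cosh_sinh kM)) (rmorph0 _)))) h.
  rewrite -(ler_pM2r (x := rho%:C ^+ M)) ?exprn_gt0 ?ltcR// (le_trans h)//.
  have -> : ((r * expR rho + expR rho) * y ^+ M)%:C * rho%:C ^+ M =
      `|z| ^+ M * ((r * expR rho + expR rho)%:C : C).
    by rewrite zE -!rmorphXn -!rmorphM (_ : (y * rho) ^+ M * _ = (r * expR rho + expR rho) * y ^+ M * rho ^+ M)// exprMn mulrC mulrA.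
  rewrite ler_wpM2l ?exprn_ge0// /D /toC rmorphB rmorphM.
  rewrite (le_trans (poly_normD _ _ rhoC))// poly_normN (rmorphD (real_complex R)) lerD//.
    rewrite (le_trans (poly_normM _ _ rhoC))// !nrm (rmorphM (real_complex R)).
    rewrite ler_pM ?lecR ?tanh_majorant ?expb ?(ltW r0)//.
      by rewrite ?ler0c sumr_ge0// => i _; rewrite mulr_ge0 ?exprn_ge0 ?(ltW rho0).
    by rewrite ?ler0c sumr_ge0// => i _; rewrite mulr_ge0 ?exprn_ge0 ?(ltW rho0).
  by rewrite nrm lecR expb.
have tcs : t * ccosh z = csinh z.
  apply/eqP; rewrite -subr_eq0; apply/eqP; apply: (cvg_unique _ _ D0).
    exact: norm_hausdorff.
  rewrite (_ : (fun M => _) = (fun M => series (fun k => (tanh_coef k)%:C * z ^+ k : C) M *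
   series (fun k => (cosh_coef R k)%:C * z ^+ k : C) M - series (fun k => (sinh_coef R k)%:C * z ^+ k : C) M)); last first.
    by apply: funext => M; exact: DE.
  exact: (cvgB (cvgM ct (@cosh_series R z)) (@sinh_series R z)).
have c0 : ccosh z != 0.
  apply/eqP => cz; have := cexp_neq0 z; have -> : cexp z = ccosh z + csinh z.
    by rewrite /ccosh /csinh; field.
  by rewrite -tcs cz mulr0 addr0 eqxx.
by split; [exact: c0 | rewrite /ctanh -tcs (mulfK c0); exact: ct].
Qed.

End TanhSeries.

(** * Composition of power series *)

Section Composition.
Variable R : realType.
Local Notation C := R[i]^o.
Variables (tau a : nat -> C) (rho r : R).
Hypotheses (rho0 : 0 < rho) (r0 : 0 < r) (tau0 : tau 0 = 0)
  (tau_norm : forall M, poly_norm rho%:C (\poly_(i < M) tau i) <= r%:C)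
  (a_norm : forall l, `|a l| * r%:C ^+ l <= 1).

(** The exact coefficient of X^k in the composite of [a] with [tau]: as [tau] has no constant term,
    its powers beyond [k] and its coefficients beyond [k] do not reach order [k]. *)
Definition compose_coef k : C := \sum_(l < k.+1) a l * ((\poly_(i < k.+1) tau i) ^+ l)`_k.

Let rhoC : 0 <= rho%:C :> R[i]. Proof. by rewrite ler0c ltW. Qed.
Let rC : 0 <= r%:C :> R[i]. Proof. by rewrite ler0c ltW. Qed.

Lemma poly_norm_tauX M l : poly_norm rho%:C ((\poly_(i < M) tau i) ^+ l) <= r%:C ^+ l.
Proof.
by rewrite (le_trans (poly_normX _ _ rhoC))// lerXn2r ?nnegrE ?poly_norm_ge0.
Qed.

Lemma compose_coef_bound k : `|compose_coef k| * rho%:C ^+ k <= k.+1%:R.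
Proof.
rewrite (le_trans (ler_wpM2r _ (ler_norm_sum _ _ _))) ?exprn_ge0// mulr_suml.
rewrite -[in leRHS](card_ord k.+1) -sumr_const; apply: ler_sum => l _.
rewrite normrM -mulrA (le_trans _ (a_norm l))// ler_wpM2l//.
by rewrite (le_trans (poly_norm_coef _ _ rhoC))// poly_norm_tauX.
Qed.

Lemma coef_tauX_stable M k l : (k < M)%N ->
  ((\poly_(i < M) tau i) ^+ l)`_k = ((\poly_(i < k.+1) tau i) ^+ l)`_k.
Proof.
have H : forall i, (i <= k)%N -> (k < M)%N ->
    ((\poly_(i < M) tau i) ^+ l)`_i = ((\poly_(i < k.+1) tau i) ^+ l)`_i.
  elim: l => [|l IH] i ik kM; first by rewrite !expr0.
  rewrite !exprS; apply: coefM_eq => b bi; last by rewrite IH// (leq_trans bi).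
  by rewrite !coef_poly (leq_ltn_trans (leq_trans bi ik) kM) ltnS (leq_trans bi ik).
exact: H.
Qed.

Lemma sum_natmul_expr (y : R) M : 0 <= y < 1 ->
  \sum_(l < M) l%:R * y ^+ l.-1 <= (1 - Num.sqrt y)^-1 * (1 - Num.sqrt y)^-1.
Proof.
move=> y01; have /andP[y0 y1] := y01.
have s0 : 0 <= Num.sqrt y by rewrite sqrtr_ge0.
have s1 : 0 < 1 - Num.sqrt y by rewrite subr_gt0 -[ltRHS]sqrtr1 ltr_sqrt.
case: M => [|M]; first by rewrite big_ord0 mulr_ge0// invr_ge0 ltW.
rewrite big_ord_recl mul0r add0r.
apply: (@le_trans _ _ (\sum_(m < M) (1 - Num.sqrt y)^-1 * Num.sqrt y ^+ m)).
  by apply: ler_sum => m _; exact: natmul_expr_le.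
rewrite -mulr_sumr ler_wpM2l ?invr_ge0 ?(ltW s1)// -[leRHS]mul1r ler_pdivlMr//.
have := subrX1 (Num.sqrt y) M; move/(congr1 -%R); rewrite opprB -mulNr opprB mulrC => <-.
by rewrite lerBlDr lerDl exprn_ge0.
Qed.

Lemma norm_subrX (x y m : C) l : `|x| <= m -> `|y| <= m ->
  `|x ^+ l - y ^+ l| <= `|x - y| * (l%:R * m ^+ l.-1).
Proof.
move=> xm ym; rewrite subrXX normrM ler_wpM2l//.
rewrite mulr_natl -[X in _ *+ X](card_ord l) -sumr_const (le_trans (ler_norm_sum _ _ _))//.
apply: ler_sum => -[i /= il] _; rewrite normrM !normrX.
have il' : (i <= l.-1)%N by lia.
have m0 : 0 <= m by apply: le_trans xm.
by rewrite -[in leRHS](subnK il') exprD ler_pM ?exprn_ge0// lerXn2r ?nnegrE.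
Qed.

(** Between the partial sums [S] of the composed series and [Rs] of the outer series at [t] stands
    [Q], the truncated outer series at the truncated inner sum. Q - S has only orders from [M] on
    and is at most of size M y^M, while Q - Rs is bounded by a multiple of |t - T M|. *)
Lemma compose_series (z t : C) : `|z| < rho%:C ->
  series (fun k => tau k * z ^+ k) @ \oo --> t ->
  `|t| < r%:C /\ forall s : C, series (fun l => a l * t ^+ l) @ \oo --> s ->
    series (fun k => compose_coef k * z ^+ k) @ \oo --> s.
Proof.
move=> zr ct.
pose y := complex.Re `|z| / rho; have y01 : 0 <= y < 1.
  rewrite divr_ge0 ?Re_norm_ge0 ?(ltW rho0)//= ltr_pdivrMr// mul1r.
  by rewrite -ltcR -norm_RRe.
have zE : `|z| = (y * rho)%:C by rewrite /y divfK ?gt_eqF// -norm_RRe.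
clearbody y; have /andP[y0 y1] := y01.
pose T M := (\poly_(i < M) tau i).[z].
have TE M : series (fun k => tau k * z ^+ k) M = T M.
  by rewrite /T horner_poly /series /= big_mkord.
(* The missing constant term of [tau] gains a factor [y], as in the Schwarz lemma. It places [t]
   strictly inside the disc of radius [r]. *)
have Tr M : `|T M| <= (y * r)%:C.
  have := horner_tail (ltW zr) (p := \poly_(i < M) tau i) (M := 1).
  have c0 k : (k < 1)%N -> (\poly_(i < M) tau i)`_k = 0.
    by case: k => // _; rewrite coef_poly tau0 if_same.
  move=> /(_ c0); rewrite !expr1 => h; have {}h := le_trans h (ler_wpM2l (normr_ge0 z) (tau_norm M)).
  rewrite -(ler_pM2r (x := rho%:C)) ?ltcR// (le_trans h)//.
  by rewrite zE -!rmorphM lecR mulrAC.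
have tr : `|t| <= (y * r)%:C.
  rewrite norm_RRe lecR; apply/ler_addgt0Pr => e e0; rewrite -lecR -norm_RRe.
  have /cvg_complexP/(_ e e0)[N /(_ N (leqnn N)) h] := ct.
  rewrite -[t](subrK (T N)) rmorphD addrC (le_trans (ler_normD _ _))// lerD ?Tr//.
  by rewrite -TE ltW.
split; first by rewrite (le_lt_trans tr)// ltcR gtr_pMl.
move=> s cs.
pose Q M : C := \sum_(l < M) a l * T M ^+ l.
pose S := series (fun k => compose_coef k * z ^+ k).
pose P M l := (\poly_(i < M) tau i) ^+ l.
have SE M : S M = \sum_(l < M) a l * (\poly_(k < M) (P M l)`_k).[z].
  rewrite /S /series /= big_mkord.
  transitivity (\sum_(k < M) \sum_(l < M) a l * (P M l)`_k * z ^+ k).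
    apply: eq_bigr => -[k /= kM] _; rewrite /compose_coef mulr_suml.
    rewrite (big_ord_widen M (fun l => a l * ((\poly_(i < k.+1) tau i) ^+ l)`_k * z ^+ k) kM).
    rewrite big_mkcond; apply: eq_bigr => -[l /= lM] _; rewrite /P (coef_tauX_stable _ kM).
    case: ltnP => // kl; rewrite coef_exp_small ?mulr0 ?mul0r//.
    by rewrite coef_poly tau0.
  rewrite exchange_big; apply: eq_bigr => l _; rewrite horner_poly mulr_sumr.
  by apply: eq_bigr => k _; rewrite mulrA.
have SQ : (fun M => Q M - S M) @ \oo --> (0 : C).
  apply: (squeeze_complex (natmul_expr_cvg0 1 y01)) => M; rewrite sub0r normrN mul1r.
  rewrite /Q SE -sumrB (le_trans (ler_norm_sum _ _ _))//.
  apply: (@le_trans _ _ (\sum_(l < M) (y ^+ M)%:C)); last first.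
    rewrite sumr_const card_ord -[leLHS]mulr_natl rmorphM /= rmorph_nat ler_wpM2r ?ler_nat//.
    by rewrite ler0c exprn_ge0.
  apply: ler_sum => l _; rewrite -mulrBr normrM /T -horner_exp -hornerN -hornerD.
  set D := _ - _; have Dlow k : (k < M)%N -> D`_k = 0.
    by move=> kM; rewrite /D coefB coef_poly kM subrr.
  have Dnorm : poly_norm rho%:C D <= r%:C ^+ l.
    apply: le_trans (poly_norm_tauX M l).
    pose n := maxn (size D) (size (P M l)).
    rewrite (@poly_normE _ n) ?leq_maxl// (@poly_normE _ n _ (_ ^+ l)) ?leq_maxr//.
    apply: ler_sum => k _; rewrite ler_wpM2r ?exprn_ge0// /D coefB coef_poly.
    by case: ifP => _; rewrite ?subrr ?normr0// subr0.
  have h := le_trans (horner_tail (ltW zr) Dlow) (ler_wpM2l (exprn_ge0 _ (normr_ge0 z)) Dnorm).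
  rewrite -(ler_pM2r (x := rho%:C ^+ M)) ?exprn_gt0 ?ltcR// -mulrA.
  rewrite (le_trans (ler_wpM2l _ h))//.
  have -> : `|a l| * (`|z| ^+ M * r%:C ^+ l) = `|a l| * r%:C ^+ l * ((y ^+ M)%:C * rho%:C ^+ M).
    by rewrite zE rmorphM exprMn (rmorphXn _ M y); ring.
  by rewrite ler_piMl// mulr_ge0 ?exprn_ge0// ler0c exprn_ge0.
pose Rs := series (fun l => a l * t ^+ l).
pose B := (1 - Num.sqrt y)^-1 * (1 - Num.sqrt y)^-1.
have QR : (fun M => Q M - Rs M) @ \oo --> (0 : C).
  have w0 : (fun M => (r^-1 * B) * complex.Re `|t - T M|) @ \oo --> (0 : R).
    rewrite -[X in _ --> X](mulr0 (r^-1 * B)); apply: cvgM; first exact: cvg_cst.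
    apply/cvgrPdist_lt => e e0; have /cvg_complexP/(_ e e0)[N h] := ct.
    exists N => // M /= /h H; rewrite sub0r normrN ger0_norm ?Re_norm_ge0//.
    by rewrite -ltcR -norm_RRe -TE.
  apply: (squeeze_complex w0) => M; rewrite sub0r normrN /Q /Rs /series /= big_mkord -sumrB.
  rewrite (le_trans (ler_norm_sum _ _ _))//.
  apply: (@le_trans _ _ (\sum_(l < M) `|t - T M| * (r^-1 * (l%:R * y ^+ l.-1))%:C)).
    apply: ler_sum => -[l /= lM] _; rewrite -mulrBr normrM.
    rewrite (le_trans (ler_wpM2l _ (norm_subrX l (Tr M) tr)))// mulrCA distrC ler_wpM2l//.
    case: l lM => [|l] lM; first by rewrite !mul0r !mulr0.
    rewrite -(ler_pM2r (x := r%:C)) ?ltcR// -rmorphXn /= exprMn !rmorphM rmorph_nat fmorphV.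
    have -> : `|a l.+1| * (l.+1%:R * ((y ^+ l)%:C * (r ^+ l)%:C)) * r%:C =
       (`|a l.+1| * r%:C ^+ l.+1) * (l.+1%:R * (y ^+ l)%:C).
      by rewrite exprSr -rmorphXn; ring.
    have -> : r%:C^-1 * (l.+1%:R * (y ^+ l)%:C) * r%:C = 1 * (l.+1%:R * (y ^+ l)%:C).
      by rewrite mulrAC mulVf// gt_eqF// ltcR.
    by rewrite ler_wpM2r// mulr_ge0 ?ler0n// ler0c exprn_ge0.
  rewrite -mulr_sumr mulrC norm_RRe -rmorph_sum -rmorphM lecR ler_wpM2r ?Re_norm_ge0//.
  by rewrite -mulr_sumr ler_wpM2l ?invr_ge0 ?(ltW r0)// sum_natmul_expr.
have SE' : S = (fun M => Rs M + (Q M - Rs M) - (Q M - S M)).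
  by apply: funext => M; ring.
rewrite -/S SE'.
rewrite -[s]addr0 -[s + 0]subr0; exact: (cvgB (cvgD cs QR) SQ).
Qed.

End Composition.

(** * Numerical values *)

Section Radius.
Variable R : realType.

Lemma t_radius_sqrt : exists s2 s3 : R, [/\ t_radius R = (s3 - s2) * (s2 - 1),
  0 < s2, 0 < s3, s2 * s2 = 2 & s3 * s3 = 3].
Proof.
exists (Num.sqrt 2), (Num.sqrt 3); split => //; rewrite ?sqrtr_gt0 ?ltr0n//.
- by rewrite -expr2 sqr_sqrtr ?ler0n.
- by rewrite -expr2 sqr_sqrtr ?ler0n.
Qed.

Lemma sqrt_lower (s c : R) : 0 < s -> 0 <= c -> c * c <= s * s -> c <= s.
Proof. by move=> s0 c0; rewrite -!expr2 ler_pXn2r// nnegrE ltW. Qed.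

Lemma t_radius_bounds :
  131 / 10 ^+ 3 + 652 / 10 ^+ 6 + 497 / 10 ^+ 9 + 586 / 10 ^+ 12 <= t_radius R
  <= 131 / 10 ^+ 3 + 652 / 10 ^+ 6 + 497 / 10 ^+ 9 + 589 / 10 ^+ 12.
Proof.
have [s2 [s3 [-> s20 s30 e2 e3]]] := t_radius_sqrt.
have l2 : 1 + 414 / 10 ^+ 3 + 213 / 10 ^+ 6 + 562 / 10 ^+ 9 + 373 / 10 ^+ 12 <= s2 by clear -s20 e2; apply: sqrt_lower; [lra | lra | rewrite e2; lra].
have u2 : s2 <= 1 + 414 / 10 ^+ 3 + 213 / 10 ^+ 6 + 562 / 10 ^+ 9 + 374 / 10 ^+ 12 by clear -s20 e2; apply: sqrt_lower; [lra | lra | rewrite e2; lra].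
have l3 : 1 + 732 / 10 ^+ 3 + 50 / 10 ^+ 6 + 807 / 10 ^+ 9 + 568 / 10 ^+ 12 <= s3 by clear -s30 e3; apply: sqrt_lower; [lra | lra | rewrite e3; lra].
have u3 : s3 <= 1 + 732 / 10 ^+ 3 + 50 / 10 ^+ 6 + 807 / 10 ^+ 9 + 569 / 10 ^+ 12 by clear -s30 e3; apply: sqrt_lower; [lra | lra | rewrite e3; lra].
have lo : (0 + 317 / 10 ^+ 3 + 837 / 10 ^+ 6 + 245 / 10 ^+ 9 + 194 / 10 ^+ 12) * (0 + 414 / 10 ^+ 3 + 213 / 10 ^+ 6 + 562 / 10 ^+ 9 + 373 / 10 ^+ 12) <= (s3 - s2) * (s2 - 1).
  clear -l2 u2 l3 u3; apply: ler_pM; [lra | lra | clear -u2 l3; lra | clear -l2; lra].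
have up : (s3 - s2) * (s2 - 1) <= (0 + 317 / 10 ^+ 3 + 837 / 10 ^+ 6 + 245 / 10 ^+ 9 + 196 / 10 ^+ 12) * (0 + 414 / 10 ^+ 3 + 213 / 10 ^+ 6 + 562 / 10 ^+ 9 + 374 / 10 ^+ 12).
  clear -l2 u2 l3 u3; apply: ler_pM; [clear -u2 l3; lra | clear -l2; lra | clear -l2 u3; lra | clear -u2; lra].
by apply/andP; split; [clear -lo; lra | clear -up; lra].
Qed.

(* This is tan (p a) for x = tan a; the radius is the case a = pi / 24. *)
Definition tan_addition (x : R) (p : nat) : R :=
  iter p (fun s => (s + x) / (1 - x * s)) 0.

Lemma tan_addition_t_radius :
  [/\ forall p, (p <= 6)%N -> 0 <= tan_addition (t_radius R) p <= 1 &
      forall p, (p < 6)%N -> tan_addition (t_radius R) p.+1 = tan_addition (t_radius R) p + t_radius R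
        + t_radius R * tan_addition (t_radius R) p * tan_addition (t_radius R) p.+1].
Proof.
set x := t_radius R; pose T := tan_addition x.
have /andP[xl xu] : 0 < x < 1 by have := t_radius_bounds; rewrite -/x; lra.
have [s2 [s3 [xE s20 s30 e2 e3]]] := t_radius_sqrt.
have TS p : T p.+1 = (T p + x) / (1 - x * T p) by [].
have Tadd p : T p <= 1 -> T p.+1 = T p + x + x * T p * T p.+1.
  move=> T1; have n0 : 1 - x * T p != 0 by rewrite subr_eq0 gt_eqF//; nra.
  by rewrite TS; field.

have ev p c c' : T p = c -> x * c < 1 -> c' * (1 - x * c) = c + x -> T p.+1 = c'.
  move=> Tc xc e; rewrite TS Tc -e mulfK// subr_eq0 gt_eqF//.
have t1 : T 1 = x by rewrite TS /T /tan_addition /= mulr0 subr0 divr1 add0r.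
have b2 : 141 / 100 <= s2 <= 142 / 100.
  by apply/andP; split; apply: sqrt_lower; rewrite ?e2; lra.
have b3 : 173 / 100 <= s3 <= 174 / 100.
  by apply/andP; split; apply: sqrt_lower; rewrite ?e3; lra.
have x17 : x <= 1 / 7 by have := t_radius_bounds; rewrite -/x; lra.
(* The values are tan (p pi / 24): the angles are pi / 12, pi / 8, pi / 6, 5 pi / 24 and pi / 4.
   Exact surds are called for because the last value attains the bound 1. *)
have t2 : T 2 = 2 - s3.
  apply: ev t1 _ _; first by nra.
  by rewrite /x xE; ring : e2 e3.
have t3 : T 3 = s2 - 1.
  apply: ev t2 _ _; first by nra.
  by rewrite /x xE; ring : e2 e3.
have t4 : T 4 = s3 / 3.
  apply: ev t3 _ _; first by nra.
  by rewrite /x xE; field : e2 e3.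
have t5 : T 5 = s2 * s3 + s3 - 2 - s2.
  apply: ev t4 _ _; first by nra.
  by rewrite /x xE; field : e2 e3.
have h5 : 0 <= s2 * s3 + s3 - 2 - s2 <= 1.
  have [/andP[s2l s2u] /andP[s3l s3u]] := (b2, b3).
  have lo : 141 / 100 * (173 / 100) <= s2 * s3 by clear -s2l s3l; apply: ler_pM => //; lra.
  have up : s2 * s3 <= 142 / 100 * (174 / 100).
    by clear -s20 s30 s2u s3u; apply: ler_pM => //; apply: ltW.
  by clear -lo up s2l s2u s3l s3u; lra.
have t6 : T 6 = 1.
  apply: ev t5 _ _; first by move: h5 x17 xl; set w := _ - s2; clear; nra.
  by rewrite /x xE; ring : e2 e3.
have T01 p : (p <= 6)%N -> 0 <= T p <= 1.
  clear -t1 t2 t3 t4 t5 t6 h5 xl xu b2 b3.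
  case: p => [|[|[|[|[|[|[|//]]]]]]] _; rewrite ?t1 ?t2 ?t3 ?t4 ?t5 ?t6 ?h5//; try by lra.
  by rewrite lexx ler01.
by split=> // p p6; apply: Tadd; have /andP[] := T01 p (ltnW p6).
Qed.

End Radius.

(** * Numerical bounds on the arctangent *)

Section ArctanBounds.
Variable R : realType.

(** The derivative of the polynomial is a truncated geometric series for 1 / (1 + x^2); multiplied
    by 1 + x^2 it becomes 1 + x^10, which is at least 1. For the lower bound one obtains 1 - x^12
    instead. *)
Lemma atan_upper (y : R) : 0 <= y ->
  atan y <= y - y ^+ 3 / 3 + y ^+ 5 / 5 - y ^+ 7 / 7 + y ^+ 9 / 9.
Proof.
move=> y0; pose p : {poly R} := 'X - 3^-1 *: 'X^3 + 5^-1 *: 'X^5 - 7^-1 *: 'X^7 + 9^-1 *: 'X^9.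
pose f (x : R) : R := atan x - p.[x].
have fd x : is_derive x (1 : R) f ((1 + x ^+ 2)^-1 - p^`().[x]).
  by apply: is_deriveB.
have := derivative_le0 y0 fd.
have pE x : p.[x] = x - x ^+ 3 / 3 + x ^+ 5 / 5 - x ^+ 7 / 7 + x ^+ 9 / 9.
  by rewrite /p !(hornerD, hornerN, hornerZ, hornerXn, hornerX); ring.
have p'E x : p^`().[x] = 1 - x ^+ 2 + x ^+ 4 - x ^+ 6 + x ^+ 8.
  by rewrite /p !(derivD, derivN, derivZ, derivXn, derivX) !(hornerD, hornerN, hornerZ, hornerMn, hornerXn, hornerC) /=; field.
rewrite /f atan0 !pE => h; rewrite -subr_le0 (le_trans (h _))//; last by rewrite expr0n /=; lra.
move=> x x0; rewrite p'E subr_le0 -[leLHS]mul1r ler_pdivrMr; last by nra.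
have -> : (1 - x ^+ 2 + x ^+ 4 - x ^+ 6 + x ^+ 8) * (1 + x ^+ 2) = 1 + x ^+ 10 by ring.
by rewrite lerDl exprn_ge0.
Qed.

Lemma atan_lower (y : R) : 0 <= y ->
  y - y ^+ 3 / 3 + y ^+ 5 / 5 - y ^+ 7 / 7 + y ^+ 9 / 9 - y ^+ 11 / 11 <= atan y.
Proof.
move=> y0; pose p : {poly R} := 'X - 3^-1 *: 'X^3 + 5^-1 *: 'X^5 - 7^-1 *: 'X^7 + 9^-1 *: 'X^9 - 11^-1 *: 'X^11.
pose f (x : R) : R := p.[x] - atan x.
have fd x : is_derive x (1 : R) f (p^`().[x] - (1 + x ^+ 2)^-1).
  by apply: is_deriveB.
have := derivative_le0 y0 fd.
have pE x : p.[x] = x - x ^+ 3 / 3 + x ^+ 5 / 5 - x ^+ 7 / 7 + x ^+ 9 / 9 - x ^+ 11 / 11.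
  by rewrite /p !(hornerD, hornerN, hornerZ, hornerXn, hornerX); ring.
have p'E x : p^`().[x] = 1 - x ^+ 2 + x ^+ 4 - x ^+ 6 + x ^+ 8 - x ^+ 10.
  by rewrite /p !(derivD, derivN, derivZ, derivXn, derivX) !(hornerD, hornerN, hornerZ, hornerMn, hornerXn, hornerC) /=; field.
rewrite /f atan0 !pE => h; rewrite -subr_le0 (le_trans (h _))//; last by rewrite expr0n /=; lra.
move=> x x0; rewrite p'E subr_le0 -[leRHS]mul1r ler_pdivlMr; last by nra.
have -> : (1 - x ^+ 2 + x ^+ 4 - x ^+ 6 + x ^+ 8 - x ^+ 10) * (1 + x ^+ 2) = 1 - x ^+ 12 by ring.
by rewrite gerBl exprn_ge0.
Qed.
End ArctanBounds.

Section AtanRadius.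
Variable R : realType.

Lemma atan_t_radius_bounds :
  0 <= atan (t_radius R) - (130 / 10 ^+ 3 + 899 / 10 ^+ 6 + 693 / 10 ^+ 9) < 1 / 10 ^+ 9.
Proof.
have := t_radius_bounds R; move: (t_radius R) => t /andP[lt tu].
(* The arctangent is pi / 24 = 0.13089969389957..., only about 10^-10 below the end 0.130899694 of
   the interval. So [b] has to exceed the radius by less than 10^-10, and the upper Taylor
   polynomial has to reach degree 9. *)
pose a : R := 131 / 10 ^+ 3 + 652 / 10 ^+ 6 + 4975 / 10 ^+ 10.
pose b : R := 131 / 10 ^+ 3 + 652 / 10 ^+ 6 + 497 / 10 ^+ 9 + 63 / 10 ^+ 11.
have /le_atan at_ : a <= t by rewrite /a; lra.
have /le_atan tb : t <= b by rewrite /b; lra.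
clear lt tu.
have a0 : 0 <= a by rewrite /a; lra.
have b0 : 0 <= b by rewrite /b; lra.
have la := le_trans (atan_lower a0) at_.
have ub := le_trans tb (atan_upper b0).
clear at_ tb a0 b0; apply/andP; split.
  rewrite subr_ge0; apply: le_trans la; clear; rewrite /a; lra.
rewrite ltrBlDr; apply: le_lt_trans ub _; clear; rewrite /b; lra.
Qed.
End AtanRadius.

(** * Correlations as rational functions *)

Section FourierUniqueness.
Variables (F : numFieldType) (T : finType) (E : {set {set T}}).
Local Notation config := {ffun T -> bool}.

Lemma horner_spin_sum (f : config -> {poly F}) (z : F) :
  (spin_sum E f).[z] = \sum_s (f s).[z] * (weight F E s).[z].
Proof. by rewrite horner_sum; apply: eq_bigr => s _; rewrite hornerM. Qed.

(** The product over all sites of 1 + s0_x s_x is a power of 2 at s = s0 and 0 elsewhere. Expanded,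
    it is a combination of characters, so the value of [g] at [s0] is a combination of vanishing
    sums. *)
Lemma character_sums_eq0 (g : config -> F) :
  (forall B, \sum_s character F B s * g s = 0) -> forall s, g s = 0.
Proof.
move=> g0 s0.
have H (l B : seq T) : \sum_s character F B s * (\prod_(x <- l) (1 + sgn F s0 x * sgn F s x)) * g s = 0.
  elim: l B => [|x l IH] B.
    by rewrite -[RHS](g0 B); apply: eq_bigr => s _; rewrite big_nil mulr1.
  transitivity (\sum_s character F B s * (\prod_(x <- l) (1 + sgn F s0 x * sgn F s x)) * g s +
     sgn F s0 x * \sum_s character F (x :: B) s * (\prod_(x <- l) (1 + sgn F s0 x * sgn F s x)) * g s).
    rewrite mulr_sumr -big_split; apply: eq_bigr => s _ /=.
    by rewrite big_cons /character big_cons; ring.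
  by rewrite !IH mulr0 addr0.
have := H (enum T) [::]; rewrite (bigD1 s0)//= [X in _ + X]big1 ?addr0; last first.
  move=> s ss0; have [x xs] : exists x, s x != s0 x.
    by apply/existsP; rewrite -negb_forall; apply: contra ss0 => /forallP h; apply/eqP/ffunP => x; apply/eqP.
  rewrite (big_rem x) ?mem_enum//= (_ : 1 + _ * _ = 0) ?mul0r ?mulr0 ?mul0r//.
  move: xs; rewrite /sgn; case: (s x) (s0 x) => -[]//= _; rewrite expr0 expr1; ring.
rewrite /character big_nil mul1r => /eqP; rewrite mulf_eq0 => /orP[|/eqP//].
rewrite (eq_bigr (fun=> 2)) => [|x _]; last by rewrite sgn2.
by rewrite prodf_seq_eq0 => /hasP[x _]; rewrite /= pnatr_eq0.
Qed.

Lemma horner_weight_neq0 s (z : F) : `|z| < 1 -> (weight F E s).[z] != 0.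
Proof.
move=> z1; rewrite horner_prod; apply/prodf_neq0 => e _.
rewrite hornerD hornerC hornerZ hornerX; apply/eqP => h.
have : `|(\prod_(x in e) sgn F s x) * z| = 1.
  by move/eqP: h; rewrite addrC addr_eq0 => /eqP ->; rewrite normrN1.
rewrite normrM normr_prod big1 ?mul1r => [z1'|x _]; first by rewrite z1' ltxx in z1.
by rewrite /sgn normrX normrN1 expr1n.
Qed.

End FourierUniqueness.

Section Correlations.
Variable R : realType.
Local Notation C := R[i]^o.

Lemma cexp_sum (I : finType) (A : {set I}) (f : I -> C) :
  cexp (\sum_(i in A) f i) = \prod_(i in A) cexp (f i).
Proof. by apply: (big_morph _ (@cexpD R) (@cexp0 R)). Qed.

Lemma cexp_sign (K : C) (b : bool) : ccosh K != 0 ->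
  cexp (K * (-1) ^+ b) = ccosh K * (1 + (-1) ^+ b * ctanh K).
Proof.
move=> c0; have -> : ccosh K * (1 + (-1) ^+ b * ctanh K) = ccosh K + (-1) ^+ b * csinh K.
  by rewrite /ctanh; field.
by case: b; rewrite ?expr1 ?expr0 ?mulrN1 ?mulN1r ?mulr1 ?mul1r /ccosh /csinh; field.
Qed.

Lemma prod_sgn_sign (T : finType) (e : {set T}) s :
  exists b : bool, \prod_(x in e) sgn C s x = (-1) ^+ b.
Proof.
exists (odd (\sum_(x in e) s x)); rewrite signr_odd.
by rewrite -prodrXr.
Qed.

Lemma boltzmann_weight n (beta J : C) (s : config n) : ccosh (beta * J) != 0 ->
  cexp (- (beta * energy J s)) =
  ccosh (beta * J) ^+ #|neighbor_pairs n| * (weight C (neighbor_pairs n) s).[ctanh (beta * J)].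
Proof.
move=> c0; rewrite /energy mulNr mulrN opprK mulrA mulr_sumr cexp_sum horner_prod.
rewrite -prodr_const -big_split; apply: eq_bigr => e _ /=.
rewrite hornerD hornerC hornerZ hornerX.
have [b bE] := prod_sgn_sign e s.
by rewrite -[\prod_(i in e) spin R s i]/(\prod_(x in e) sgn C s x) bE cexp_sign.
Qed.

Lemma partition_functionE n (beta J : C) : ccosh (beta * J) != 0 ->
  partition_function n beta J = ccosh (beta * J) ^+ #|neighbor_pairs n| *
    (spin_sum (neighbor_pairs n) (fun=> 1)).[ctanh (beta * J)].
Proof.
move=> c0; rewrite horner_spin_sum mulr_sumr; apply: eq_bigr => s _.
by rewrite boltzmann_weight// hornerC mul1r.
Qed.

(** At Z = 0 both sides are 0 by the convention for the inverse of 0. Thus correlations can be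
    rewritten for every [n] before anything is known about zeros of the partition function. *)
Lemma quotient_scale (F : fieldType) (c w Z P : F) : c != 0 -> w != 0 ->
  (c * Z)^-1 * (c * P) = w^-1 * P / (w^-1 * Z).
Proof.
move=> c0 w0.
have [->|Z0] := eqVneq Z 0; first by rewrite !mulr0 invr0 mul0r mulr0.
by field; rewrite c0 w0 Z0.
Qed.

Definition points m (j : 'I_m -> lattice_point) : seq lattice_point := [seq j a | a <- enum 'I_m].

Lemma correlationE m (j : 'I_m -> lattice_point) n (beta J : C) : ccosh (beta * J) != 0 ->
  correlation j n beta J =
  (corr_num C (neighbor_pairs n) (map (to_site n) (points j))).[ctanh (beta * J)] /
  (corr_num C (neighbor_pairs n) [::]).[ctanh (beta * J)].
Proof.
move=> c0; rewrite /correlation /average partition_functionE//.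
set t := ctanh _; set c := ccosh _ ^+ _; set E := neighbor_pairs n.
have -> : \sum_s (\prod_(a < m) spin R s (to_site n (j a))) * cexp (- (beta * energy J s)) =
   c * (spin_sum E (fun s => (character C (map (to_site n) (points j)) s)%:P)).[t].
  rewrite horner_spin_sum mulr_sumr; apply: eq_bigr => s _.
  rewrite boltzmann_weight// -/c hornerC mulrCA; congr (_ * (_ * _)).
  by rewrite /character /points -map_comp big_map big_enum.
rewrite /corr_num !hornerZ.
rewrite spin_sum_nil; apply: quotient_scale; last exact: spin_sum1_neq0.
by rewrite expf_neq0.
Qed.

Lemma in_box_points m (j : 'I_m -> lattice_point) : in_box (points j) (largest_edge j).
Proof.
exists (fun c => \big[Num.min/head 0 [seq (x : lattice_point) c | x <- points j]]_(x <- [seq (x : lattice_point) c | x <- points j]) x).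
move=> y yj c; set s := [seq (x : lattice_point) c | x <- points j].
have ys : y c \in s by apply: map_f.
have lo : \big[Num.min/head 0 s]_(x <- s) x <= y c by apply: (bigmin_inf_seq _ (y c)).
have up : y c <= \big[Num.max/head 0 s]_(x <- s) x by apply: (bigmax_sup_seq _ (y c)).
rewrite lo /=; apply: (le_trans up).
have : (`|edge_length j c| <= largest_edge j)%N.
  by apply: (leq_bigmax (F := fun c => `|edge_length j c|%N) c).
have -> : edge_length j c = \big[Num.max/head 0 s]_(x <- s) x - \big[Num.min/head 0 s]_(x <- s) x.
  by rewrite /edge_length /s /points -map_comp.
move: (\big[_/_]_(x <- _) x) (\big[_/_]_(x <- _) x) => M l.
lia.
Qed.

Lemma lattice_coef_bound n C0 k : (0 < n)%N ->
  `|lattice_coef C n C0 k| * (t_radius R)%:C ^+ k <= 1.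
Proof.
move=> n0; set x := t_radius R.
have [T01 TS] := tan_addition_t_radius R.
have x0 : 0 <= x by have := t_radius_bounds R; rewrite -/x; lra.
(* The bounds on [tan_addition] are established up to 6, the number of neighbors; capping [p] there
   gives a sequence that is nonnegative for every [p]. *)
apply: (@corr_coef_bound _ _ _ (@card_neighbor_pair n) x%:C
  (fun p => (tan_addition x (minn p 6))%:C) 6).
- by rewrite ler0c.
- by move=> p; rewrite ler0c; have /andP[] := T01 (minn p 6) (geq_minr _ _).
- by move=> p p6; rewrite lecR; have /andP[] := T01 (minn p 6) (geq_minr _ _).
- move=> p p6; rewrite (minn_idPl p6) (minn_idPl (ltnW p6)) -!rmorphM -!rmorphD.
  by rewrite {1}TS.
- by move=> i; exact: neighbor_list.
Qed.

End Correlations.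

(** * Thermodynamic limit *)

Section UniformConvergence.
Variable R : realType.
Local Notation C := R[i]^o.

Lemma power_series_tail (c : nat -> C) (r y : R) (z : C) : 0 < r -> 0 <= y < 1 ->
  `|z| <= (y * r)%:C -> (forall k, `|c k| * r%:C ^+ k <= k.+1%:R) ->
  exists2 l : C, power_series c z @ \oo --> l &
    forall M, `|l - power_series c z M| <=
      ((1 - Num.sqrt y)^-1 / (1 - Num.sqrt y) * Num.sqrt y ^+ M)%:C.
Proof.
move=> r0 y01 zy cb; have /andP[y0 y1] := y01.
have s0 : 0 <= Num.sqrt y by rewrite sqrtr_ge0.
have s1 : Num.sqrt y < 1 by rewrite -[ltRHS]sqrtr1 ltr_sqrt.
apply: complex_series_geometric; first by rewrite invr_ge0 subr_ge0 ltW.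
  by rewrite s0.
move=> k; rewrite normrM normrX.
apply: (@le_trans _ _ (`|c k| * (y * r)%:C ^+ k)).
  by rewrite ler_wpM2l// lerXn2r ?nnegrE// (le_trans _ zy).
rewrite rmorphM exprMn mulrCA mulrC -(rmorphXn _ k y).
apply: (@le_trans _ _ (k.+1%:R * (y ^+ k)%:C)).
  by rewrite ler_wpM2r// ler0c exprn_ge0.
by rewrite -(rmorph_nat (real_complex R)) -rmorphM lecR natmul_expr_le.
Qed.

Lemma cvg_uniformly_of_bound (P : option nat -> Prop) (a : option nat -> nat -> C) (r : R) :
  0 < r -> (forall N, P N -> forall k, `|a N k| * r%:C ^+ k <= k.+1%:R) ->
  cvg_uniformly_in_size P a r.
Proof.
move=> r0 ab q qr A /uniform_nbhs [E [entE sub]].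
move: entE; rewrite -entourage_ballE => -[e /= e0 Ee].
(* For negative [q] no point satisfies the condition on its norm, and any threshold will do. *)
have [q0|q0] := ltP q 0.
  exists 0 => // M _; apply: sub => -[N z] /= [_ zq]; exfalso.
  by have := le_trans (normr_ge0 z) zq; rewrite ler0c leNgt q0.
pose y := q / r; have y01 : 0 <= y < 1.
  by rewrite divr_ge0 ?(ltW r0)//= ltr_pdivrMr// mul1r.
have qE : q = y * r by rewrite /y divfK// gt_eqF.
have s01 : 0 <= Num.sqrt y < 1.
  by rewrite sqrtr_ge0 -[ltRHS]sqrtr1 ltr_sqrt//=; have /andP[] := y01.
have eE := ge0_RRe (ltW e0); have e'0 : 0 < complex.Re e by rewrite -ltcR -eE.
have [M0 hM0] := cvg0_natP (geometric0 ((1 - Num.sqrt y)^-1 / (1 - Num.sqrt y)) s01) e'0.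
exists M0 => // M /= /hM0 hM; apply: sub => -[N z] /= [PN zq]; apply: Ee.
rewrite qE in zq.
have [l cl tl] := power_series_tail r0 y01 zq (ab N PN).
rewrite (cvg_lim _ cl); last exact: norm_hausdorff.
rewrite -ball_normE /= (le_lt_trans (tl M))// eE ltcR; exact: hM.
Qed.

End UniformConvergence.

(** * Finite and infinite-volume correlations as sums of their series *)

Section Limits.
Variables (R : realType) (m : nat) (j : 'I_m -> lattice_point).
Local Notation C := R[i]^o.
Local Notation r := (t_radius R).

(** With d the largest edge, k + d + 1 is the least [n] with k < n - d, from which on coefficient
    [k] no longer changes. *)
Definition corr_series_coef (N : option nat) (k : nat) : C :=
  if N is Some n then lattice_coef C n (points j) k
  else lattice_coef C (k + largest_edge j).+1 (points j) k.

Lemma t_radius_gt0 : 0 < r.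
Proof. by have := t_radius_bounds R; lra. Qed.

Lemma corr_series_coef_bound N : fits_at j N -> forall k,
  `|corr_series_coef N k| * r%:C ^+ k <= 1.
Proof. by case: N => [n [n0 _]|_] k; apply: lattice_coef_bound. Qed.

Lemma corr_series_coef_stable n k N : (k < n - largest_edge j)%N ->
  (if N is Some n' then (n < n')%N else true) ->
  corr_series_coef (Some n) k = corr_series_coef N k.
Proof.
move=> kn; have box := in_box_points j.
have kn' : (largest_edge j + k < n)%N by lia.
case: N => [n' nn'|_] /=; first exact: lattice_coef_stable (ltnW nn') box kn'.
by apply/esym; apply: lattice_coef_stable box _; lia.
Qed.

Lemma corr_num_series n B (t : C) : (0 < n)%N -> `|t| < r%:C ->
  (fun M => (corr_num C (neighbor_pairs n) [::]).[t] *
     series (fun k => corr_coef C (neighbor_pairs n) B k * t ^+ k) M) @ \oo -->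
  ((corr_num C (neighbor_pairs n) B).[t] : C).
Proof.
move=> n0 tr; apply: (quotient_series t_radius_gt0) => //.
  (* Every site is the image of a lattice point, so the bound covers arbitrary lists of sites. *)
  move=> k; have := @lattice_coef_bound R n [seq [ffun c => ((i : site n) c : nat)%:Z] | i <- B] k n0.
  rewrite /lattice_coef -map_comp (eq_map (g := id)) ?map_id// => i /=.
  by rewrite -to_site_surj.
by move=> M k kM; rewrite corr_coef_quotient.
Qed.

Lemma corr_num_nil_neq0 n (t : C) : (0 < n)%N -> `|t| < r%:C ->
  (corr_num C (neighbor_pairs n) [::]).[t] != 0.
Proof.
move=> n0 tr; apply/eqP => Z0.
(* At a zero of the partition polynomial the sequence of [corr_num_series] is constantly 0, yet it
   converges to the numerator. *)
have P0 B : (corr_num C (neighbor_pairs n) B).[t] = 0.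
  have := @corr_num_series n B t n0 tr.
  rewrite Z0 (_ : (fun M => _) = (fun=> 0 : C)); last by apply: funext => M; rewrite mul0r.
  by move=> h; apply: (cvg_unique _ h (cvg_cst _)); exact: norm_hausdorff.
have S0 B : \sum_s character C B s * (weight C (neighbor_pairs n) s).[t] = 0.
  move/eqP: (P0 B); rewrite hornerZ mulf_eq0 invr_eq0 (negPf (spin_sum1_neq0 _ _)) /=.
  rewrite horner_spin_sum => /eqP h; rewrite -[RHS]h; apply: eq_bigr => s _.
  by rewrite hornerC.
have := character_sums_eq0 S0 [ffun=> false] => /eqP; apply/negP.
apply: horner_weight_neq0; rewrite (lt_trans tr)//.
by rewrite -[1]/((1:R)%:C) ltcR; have := t_radius_bounds R; lra.
Qed.

Definition finite_correlation n (t : C) : C :=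
  (corr_num C (neighbor_pairs n) (map (to_site n) (points j))).[t] /
  (corr_num C (neighbor_pairs n) [::]).[t].

Lemma corr_series_finite n (t : C) : (0 < n)%N -> `|t| < r%:C ->
  power_series (corr_series_coef (Some n)) t @ \oo --> finite_correlation n t.
Proof.
move=> n0 tr; have Z0 := corr_num_nil_neq0 n0 tr.
have h := @corr_num_series n (map (to_site n) (points j)) t n0 tr.
have {h} := cvgM h (cvg_cst (((corr_num C (neighbor_pairs n) [::]).[t])^-1 : C)).
rewrite (_ : _ \* _ = power_series (corr_series_coef (Some n)) t) => [h|]; first exact: h.
by apply: funext => M /=; rewrite mulrAC mulfV// mul1r.
Qed.

Lemma corr_series_infinite (t : C) : `|t| < r%:C -> exists2 l : C,
  power_series (corr_series_coef None) t @ \oo --> l &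
  (fun n => finite_correlation n t) @ \oo --> l.
Proof.
move=> tr; have r0 := t_radius_gt0.
pose y := complex.Re `|t| / r; have y01 : 0 <= y < 1.
  rewrite divr_ge0 ?Re_norm_ge0 ?(ltW r0)//= ltr_pdivrMr// mul1r.
  by rewrite -ltcR -norm_RRe.
have ty : `|t| <= (y * r)%:C by rewrite /y divfK ?gt_eqF// -norm_RRe.
clearbody y.
have bound N : fits_at j N -> forall k, `|corr_series_coef N k| * r%:C ^+ k <= k.+1%:R.
  move=> fN k; apply: (le_trans (corr_series_coef_bound fN k)); by rewrite ler1n.
have boundS n : (0 < n)%N -> forall k, `|corr_series_coef (Some n) k| * r%:C ^+ k <= k.+1%:R.
  by move=> n0 k; apply: (@le_trans _ _ 1); [exact: lattice_coef_bound | rewrite ler1n].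
have [l cl tl] := power_series_tail r0 y01 ty (bound None I).
exists l => //; apply/cvg_complexP => e e0.
set K := (1 - Num.sqrt y)^-1 / (1 - Num.sqrt y) in tl.
have s01 : 0 <= Num.sqrt y < 1.
  by rewrite sqrtr_ge0 -[ltRHS]sqrtr1 ltr_sqrt//=; have /andP[] := y01.
have [M0 hM0] := cvg0_natP (geometric0 (K + K) s01) e0.
(* From this size on, all coefficients below order [M0] equal those of the infinite lattice. The two
   sums then differ only by their tails, which have a common bound. *)
exists (M0 + largest_edge j).+1 => n nM.
have n0 : (0 < n)%N by apply: leq_trans nM.
have [l' cl' tl'] := power_series_tail r0 y01 ty (boundS n n0).
have -> : finite_correlation n t = l'.
  by apply: (cvg_unique _ (corr_series_finite n0 tr) cl'); exact: norm_hausdorff.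
have eq : power_series (corr_series_coef None) t M0 = power_series (corr_series_coef (Some n)) t M0.
  rewrite /power_series /series /= !big_mkord; apply: eq_bigr => -[k /= kM] _.
  congr (_ * _); apply/esym; apply: (@corr_series_coef_stable n k None) => //.
  by rewrite ltn_subRL addnC (leq_trans _ nM)// ltnS leq_add2r ltnW.
have -> : l - l' = (l - power_series (corr_series_coef None) t M0) -
   (l' - power_series (corr_series_coef (Some n)) t M0).
  by rewrite -eq; ring.
rewrite (le_lt_trans (ler_normB _ _))// (le_lt_trans (lerD (tl M0) (tl' M0)))//.
by rewrite -rmorphD ltcR -mulrDl hM0.
Qed.

Lemma correlation_series (beta J : C) :
  ccosh (beta * J) != 0 -> `|ctanh (beta * J)| < r%:C ->
  [/\ forall n, fits j n -> partition_function n beta J != 0,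
      cvgn (fun n => correlation j n beta J) &
      forall N, fits_at j N ->
        power_series (corr_series_coef N) (ctanh (beta * J)) @ \oo --> correlation_at j N beta J].
Proof.
move=> c0 tr; have [l cl cfl] := corr_series_infinite tr.
have corrE : (fun n => correlation j n beta J) = (fun n => finite_correlation n (ctanh (beta * J))).
  by apply: funext => n; rewrite correlationE.
have ccl : (fun n => correlation j n beta J) @ \oo --> l by rewrite corrE.
split.
- move=> n [n0 _]; rewrite partition_functionE// mulf_neq0 ?expf_neq0//.
  have := corr_num_nil_neq0 n0 tr; rewrite hornerZ mulf_eq0 negb_or => /andP[_].
  by rewrite spin_sum_nil.
- by apply/cvg_ex; exists l.
- case=> [n [n0 _]|_].
    have h := corr_series_finite n0 tr.
    by rewrite /finite_correlation -(correlationE j n c0) in h.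
  have -> : correlation_at j None beta J = l.
    by apply: (cvg_lim _ ccl); exact: norm_hausdorff.
  exact: cl.
Qed.

Definition corr_series_beta (N : option nat) : nat -> C :=
  compose_coef (fun k => (tanh_coef R k)%:C) (corr_series_coef N).

Lemma poly_norm_tanh (M : nat) :
  poly_norm (atan r)%:C (\poly_(k < M) ((tanh_coef R k)%:C : C)) <= r%:C.
Proof.
rewrite poly_norm_poly; have := tanh_majorant M (ltW t_radius_gt0); rewrite -lecR.
apply: le_trans; rewrite rmorph_sum le_eqVlt; apply/orP; left; apply/eqP.
apply: eq_bigr => k _.
by rewrite normc_def /= expr0n addr0 sqrtr_sqr rmorphM rmorphXn.
Qed.

Lemma atan_t_radius_gt0 : 0 < atan r.
Proof. by rewrite -(@atan0 R) lt_atan ?t_radius_gt0. Qed.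

Lemma corr_series_beta_bound N : fits_at j N -> forall k,
  `|corr_series_beta N k| * (atan r)%:C ^+ k <= k.+1%:R.
Proof.
move=> fN k; apply: (compose_coef_bound atan_t_radius_gt0 t_radius_gt0 poly_norm_tanh).
exact: corr_series_coef_bound.
Qed.

Lemma correlation_series_beta (beta J : C) : `|beta * J| < (atan r)%:C ->
  [/\ forall n, fits j n -> partition_function n beta J != 0,
      cvgn (fun n => correlation j n beta J) &
      forall N, fits_at j N ->
        power_series (corr_series_beta N) (beta * J) @ \oo --> correlation_at j N beta J].
Proof.
move=> zr; have [c0 ct] := tanh_series t_radius_gt0 zr.
have compose N (fN : fits_at j N) := compose_series atan_t_radius_gt0 t_radius_gt0
  (congr1 (real_complex R) (tanh_coef0 R)) poly_norm_tanh (corr_series_coef_bound fN) zr ct.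
have [tr _] := compose None I; have [pn cc cs] := correlation_series c0 tr.
split; [exact: pn | exact: cc | move=> N fN].
by have [_ h] := compose N fN; exact: (h _ (cs N fN)).
Qed.

End Limits.

Local Open Scope classical_set_scope.
Local Open Scope ring_scope.
Local Open Scope complex_scope.

Theorem theorem2 (R : realType) (m : nat) (j : 'I_m -> lattice_point) :
  exists a b : option nat -> nat -> R[i]^o,
    [/\ cvg_uniformly_in_size (fits_at j) a (t_radius R),
        cvg_uniformly_in_size (fits_at j) b (atan (t_radius R)),
        forall beta J : R[i]^o,
          ccosh (beta * J) != 0 -> `|ctanh (beta * J)| < (t_radius R)%:C ->
          [/\ forall n, fits j n -> partition_function n beta J != 0,
              cvgn (fun n => correlation j n beta J) &
              forall N, fits_at j N ->
                power_series (a N) (ctanh (beta * J)) @ \oo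
                  --> correlation_at j N beta J],
        forall beta J : R[i]^o,
          `|beta * J| < (atan (t_radius R))%:C ->
          [/\ forall n, fits j n -> partition_function n beta J != 0,
              cvgn (fun n => correlation j n beta J) &
              forall N, fits_at j N ->
                power_series (b N) (beta * J) @ \oo
                  --> correlation_at j N beta J] &
        forall n k : nat, (k < n - largest_edge j)%N ->
          forall N : option nat, (if N is Some n' then (n < n')%N else true) ->
            a (Some n) k = a N k]
    /\ [/\ 0 <= t_radius R - (131 / 10 ^+ 3 + 652 / 10 ^+ 6 + 497 / 10 ^+ 9)
             < 1 / 10 ^+ 9 &
           0 <= atan (t_radius R)
                - (130 / 10 ^+ 3 + 899 / 10 ^+ 6 + 693 / 10 ^+ 9)
             < 1 / 10 ^+ 9].
Proof.
exists (corr_series_coef R j), (corr_series_beta R j); split; split.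
- apply: cvg_uniformly_of_bound; first exact: t_radius_gt0.
  move=> N fN k; apply: (le_trans (corr_series_coef_bound R fN k)); by rewrite ler1n.
- apply: cvg_uniformly_of_bound; first exact: atan_t_radius_gt0.
  by move=> N fN k; exact: corr_series_beta_bound.
- exact: correlation_series.
- exact: correlation_series_beta.
- by move=> n k kn N nN; exact: corr_series_coef_stable.
- by have := t_radius_bounds R; lra.
- exact: atan_t_radius_bounds.
Qed.
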